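(* In the financial market $\mathcal{M}$ with volatility uncertainty there does not exist any arbitrage opportunity. That is, there do not exist an initial wealth $y\le0$ and an admissible pair $(\pi,C)\in\mathcal{A}(y)$ with $C\equiv0$ such that, at some time $T>0$, $X^{y,\pi,0}_T\ge0$ quasi-surely and $P(X^{y,\pi,0}_T>0)>0$ for at least one $P\in\mathcal{P}$.
   Context: G-framework. Fix $T>0$ (time horizon) and $0<\underline{\sigma}<\overline{\sigma}$; $G(y)=\frac12\overline{\sigma}^2y^+-\frac12\underline{\sigma}^2y^-$. $\Omega_T=C_0([0,T],\mathbb{R})$ is the space of continuous paths starting at $0$, $\mathcal{F}=\mathcal{B}(\Omega_T)$ its Borel $\sigma$-algebra, $B_t(\omega)=\omega_t$ the canonical process. $(\Omega_T,\mathcal{F},P_0)$ is a probability space carrying a classical Brownian motion $W$, and $\mathcal{F}_t=\sigma\{W_s\mid 0\le s\le t\}\vee\mathcal{N}$, $\mathcal{N}$ the $P_0$-null sets. For each $[\underline{\sigma},\overline{\sigma}]$-valued $(\mathcal{F}_t)$-adapted process $\theta$ on $[0,T]$, $P^\theta$ is the law under $P_0$ of $\int_0^\cdot\theta_s\,dW_s$. The set of priors $\mathcal{P}$ is the closure of all such $P^\theta$ under weak convergence. The G-expectation is $E_G(X)=\sup_{P\in\mathcal{P}}E^P(X)$; under $E_G$, $B$ is a G-Brownian motion. A property holds quasi-surely (q.s.) if it holds outside a set $A\in\mathcal{F}$ with $P(A)=0$ for all $P\in\mathcal{P}$; (in)equalities are understood q.s. Spaces. $L_{ip}(\Omega_t)$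 is the set of $\varphi(B_{t_1},\dots,B_{t_n})$ with $n\in\mathbb{N}$, $t_i\in[0,t]$ and $\varphi$ real-valued on $\mathbb{R}^n$ with $|\varphi(x)-\varphi(y)|\le C(1+|x|^k+|y|^k)|x-y|$ for some $C,k$. $L^p_G(\Omega_T)$ is the completion of $L_{ip}(\Omega_T)$ under $\|\xi\|_p=E_G(|\xi|^p)^{1/p}$. $H^p_G(0,T)$, $p\ge1$, is the completion of the simple processes $\eta_t=\sum_{j=0}^{N-1}\xi_j1_{[t_j,t_{j+1})}(t)$, $\xi_j\in L_{ip}(\Omega_{t_j})$, $\{t_0,\dots,t_N\}$ a partition of $[0,T]$, under $\left(E_G\left(\int_0^T|\eta_s|^2ds\right)^{p/2}\right)^{1/p}$; the Itô integral $\int_0^T\eta_s\,dB_s=\sum_j\xi_j(B_{t_{j+1}}-B_{t_j})$ extends continuously to $H^p_G(0,T)\to L^p_G(\Omega_T)$. Market $\mathcal{M}$. A riskless bond $d\gamma_t=r\gamma_t\,dt$, $\gamma_0=1$, with constant $r\ge0$, and a stock $dS_t=rS_t\,dt+S_t\,dB_t$, $S_0=x_0>0$. A portfolio process is an $(\mathcal{F}_t)$-adapted real-valued process $\pi$ with values in $L^1_G(\Omega_T)$ (proportion of wealth invested in the stock). A cumulative consumption process $C$ is a nonnegative $(\mathcal{F}_t)$-adapted process with values in $L^1_G(\Omega_T)$, increasing RCLL paths on $(0,T]$, $C_0=0$, $C_T<\infty$ q.s. The wealth process $X=X^{y,\pi,C}$ with initial capital $y\in\mathbb{R}$ is the unique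 solution (if it exists) of $$\gamma_t^{-1}X_t=y-\int_0^t\gamma_u^{-1}dC_u+\int_0^t\gamma_u^{-1}X_u\pi_u\,dB_u,\quad t\le T.$$ The pair $(\pi,C)$ is admissible for $y$, written $(\pi,C)\in\mathcal{A}(y)$, if $\pi$ is a portfolio process, $C$ is a cumulative consumption process, the wealth process $X^{y,\pi,C}$ exists (as the unique solution of its defining integral equation), $(\pi_tX^{y,\pi,C}_t)\in H^1_G(0,T)$, and $X^{y,\pi,C}_t\ge-L$ for all $t\le T$ q.s. for some nonnegative $L\in L^2_G(\Omega_T)$. *)

(* Defs.v *)
From HB Require Import structures.
From mathcomp Require Import all_boot all_order all_algebra.
From mathcomp Require Import all_classical all_reals all_analysis.
Set Implicit Arguments.
Unset Strict Implicit.
Unset Printing Implicit Defensive.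
Import Order.TTheory GRing.Theory Num.Theory.
Import numFieldNormedType.Exports.
Local Open Scope classical_set_scope.
Local Open Scope ring_scope.

Section path_space.
Context {R : realType}.
Implicit Type T : R.

(* A path is a total function [R -> R]; the value 0 outside [0, T] is only a
   normalisation that makes the path determined by its restriction to [0, T]. *)
Definition is_path T (f : R -> R) : Prop :=
  [/\ {within `[0, T], continuous f}, f 0 = 0 &
      forall t : R, t \notin `[0, T] -> f t = 0].

Lemma is_path0 T : is_path T (fun=> 0).
Proof. by split=> // t; exact: cvg_cst. Qed.

Definition path_of T : Type := {f : R -> R | is_path T f}.

HB.instance Definition _ T := gen_eqMixin (path_of T).
HB.instance Definition _ T := gen_choiceMixin (path_of T).

Definition path_fun T (w : path_of T) : {uniform` `[0, T] -> R} := sval w.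

(* C_0([0, T]) with the topology of uniform convergence on [0, T] ... *)
Definition Omega T : Type := initial_topology (@path_fun T).

HB.instance Definition _ T := Topological.copy (Omega T)
  (initial_topology (@path_fun T)).
HB.instance Definition _ T :=
  isPointed.Build (Omega T) (exist _ _ (is_path0 T)).

(* ... and with its Borel sigma-algebra. *)
HB.instance Definition _ T := Measurable.copy (Omega T)
  (g_sigma_algebraType (@open (Omega T))).

Definition B {T} (t : R) (w : Omega T) : R := sval w t.

End path_space.

Section partitions.
Context {R : realType}.

Definition partition (a b : R) (N : nat) (t : nat -> R) : Prop :=
  [/\ t 0%N = a, t N = b & forall j, (j < N)%N -> t j < t j.+1].

(* \int_0^t f dc = v as a Riemann-Stieltjes integral; a jump of c at 0+ is
   counted. *)
Definition is_stieltjes (f c : R -> R) (t v : R) : Prop :=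
  forall e : R, 0 < e -> exists2 d, 0 < d &
    forall N (u x : nat -> R), partition 0 t N u ->
      (forall j, (j < N)%N ->
         u j.+1 - u j < d /\ u j <= x j <= u j.+1) ->
      `|\sum_(j < N) f (x j) * (c (u j.+1) - c (u j)) - v| < e.

End partitions.

Section step_processes.
Context {R : realType} {T : R}.
Local Notation Omega := (Omega T).

(* xi_j on [t_j, t_(j+1)[ for j < N *)
Record step := Step {
  step_size : nat ;
  step_node : nat -> R ;
  step_coef : nat -> Omega -> R }.

Definition step_process (h : step) (s : R) (w : Omega) : R :=
  \sum_(j < step_size h)
    step_coef h j w * (step_node h j <= s < step_node h j.+1)%R%:R.

(* \int_0^u h dM *)
Definition step_integral (h : step) (M : R -> Omega -> R) (u : R)
    (w : Omega) : R :=
  \sum_(j < step_size h) step_coef h j w *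
    (M (Num.min (step_node h j.+1) u) w - M (Num.min (step_node h j) u) w).

Definition jointly_measurable (eta : R -> Omega -> R) : Prop :=
  measurable_fun (`[0, T] `*` [set: Omega])
    (fun p : R * Omega => eta p.1 p.2).

Definition adapted (F : R -> set (set Omega)) (X : R -> Omega -> R) : Prop :=
  forall t : R, t \in `[0, T] -> forall A : set R, measurable A ->
    F t (X t @^-1` A).

End step_processes.
Arguments step {R} T.

Section priors.
Context {R : realType} {T : R}.
Local Notation Omega := (Omega T).
Variables (P0 : probability Omega R) (W : R -> Omega -> R).

Definition generated_past (t : R) : set (set Omega) :=
  <<s \bigcup_(s in `[0, t])
        preimage_set_system setT (W s) (measurable : set (set R)) >>.

Definition brownian_motion : Prop :=
  [/\ forall t : R, t \in `[0, T] -> measurable_fun setT (W t),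
      {ae P0, forall w, W 0 w = 0 /\ {within `[0, T], continuous (W ^~ w)}},
      (forall s t : R, 0 <= s -> s < t -> t <= T ->
         forall A : set R, measurable A ->
         P0 ((W t \- W s) @^-1` A) = normal_prob 0 (Num.sqrt (t - s)) A) &
      (forall s t : R, 0 <= s -> s < t -> t <= T ->
         forall (A : set Omega) (D : set R),
         generated_past s A -> measurable D ->
         let I := W t \- W s in
         P0 (A `&` I @^-1` D) = (P0 A * P0 (I @^-1` D))%E)].

(* Null sets are elements of the Borel sigma-algebra: a Borel set belongs to
   the sigma-algebra below iff it does after completion of P0. *)
Definition filtration (t : R) : set (set Omega) :=
  <<s generated_past t `|` [set N | measurable N /\ P0 N = 0%E] >>.

Definition adapted_step (h : step T) : Prop :=
  partition 0 T (step_size h) (step_node h) /\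
  forall j, (j < step_size h)%N ->
    (forall A : set R, measurable A ->
       filtration (step_node h j) (step_coef h j @^-1` A)) /\
    exists M : R, forall w, `|step_coef h j w| <= M.

(* M is a continuous version of \int_0^. theta dW *)
Definition is_ito_integral (theta : R -> Omega -> R) (M : Omega -> Omega) :
    Prop :=
  measurable_fun setT M /\
  exists h : nat -> step T,
    [/\ forall n, adapted_step (h n),
        (\int[P0]_w \int[lebesgue_measure]_(s in `[0%R, T])
            ((theta s w - step_process (h n) s w) ^+ 2)%:E)%E
          @[n --> \oo] --> 0%E &
        forall t : R, t \in `[0, T] ->
          (\int[P0]_w ((B t (M w) - step_integral (h n) W t w) ^+ 2)%:E)%E
            @[n --> \oo] --> 0%E].

(* the laws P^theta *)
Definition volatility_laws (sl su : R) : set (probability Omega R) :=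
  [set P | exists (theta : R -> Omega -> R) (M : Omega -> Omega),
    [/\ jointly_measurable theta, adapted filtration theta,
        forall (t : R) w, t \in `[0, T] -> sl <= theta t w <= su,
        is_ito_integral theta M &
        forall A, measurable A -> P A = P0 (M @^-1` A)]].

Definition bounded_continuous : Type :=
  {f : Omega -> R | continuous f /\ exists M : R, forall w, `|f w| <= M}.

Definition bc_integral (P : probability Omega R) :
    {ptws bounded_continuous -> R} :=
  fun f => (\int[P]_w sval f w)%R.

(* [initial_topology bc_integral] is the topology of weak convergence of
   probability measures *)
Definition priors (sl su : R) : set (probability Omega R) :=
  closure (volatility_laws sl su : set (initial_topology bc_integral)).

End priors.

Section G_expectation.
Context {R : realType} {T : R}.
Local Notation Omega := (Omega T).
Variable Q : set (probability Omega R).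

Definition E_G (X : Omega -> \bar R) : \bar R :=
  ereal_sup [set (\int[P]_w X w)%E | P in Q].

Definition qs (A : set Omega) : Prop :=
  exists N : set Omega,
    [/\ measurable N, forall P, Q P -> P N = 0%E & ~` A `<=` N].

(* The norm on 'rV_n is the sup norm, which defines the same class of
   functions phi as the Euclidean one. *)
Definition Lip (t : R) : set (Omega -> R) :=
  [set X | exists n (s : 'I_n.+1 -> R) (phi : 'rV[R]_n.+1 -> R),
    [/\ forall i, s i \in `[0, t],
        (exists (K : R) (k : nat), forall x y,
           `|phi x - phi y| <= K * (1 + `|x| ^+ k + `|y| ^+ k) * `|x - y|) &
        X = fun w => phi (\row_i B (s i) w)]].

Definition LG_norm (p : R) (X : Omega -> R) : \bar R :=
  poweR (E_G (fun w => (`|X w| `^ p)%:E)) p^-1.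

(* Elements of the completion are represented by Borel functions, two of which
   represent the same element iff they are equal q.s. *)
Definition LG (p : R) : set (Omega -> R) :=
  [set X : Omega -> R | measurable_fun setT X /\
    exists2 Z : nat -> Omega -> R, forall n, Lip T (Z n) &
      LG_norm p (X \- Z n) @[n --> \oo] --> 0%E].

Definition HG_norm (p : R) (eta : R -> Omega -> R) : \bar R :=
  poweR (E_G (fun w => poweR
    (\int[lebesgue_measure]_(s in `[0%R, T]) (`|eta s w| ^+ 2)%:E)%E (p / 2)))
    p^-1.

Definition Lip_step (h : step T) : Prop :=
  partition 0 T (step_size h) (step_node h) /\
  forall j, (j < step_size h)%N -> Lip (step_node h j) (step_coef h j).

Definition HG_approx (p : R) (eta : R -> Omega -> R) (h : nat -> step T) :
    Prop :=
  (forall n, Lip_step (h n)) /\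
  HG_norm p (fun s w => eta s w - step_process (h n) s w)
    @[n --> \oo] --> 0%E.

Definition HG (p : R) : set (R -> Omega -> R) :=
  [set eta | jointly_measurable eta /\ exists h, HG_approx p eta h].

(* eta is in H^p_G and I = \int_0^t eta dB in L^p_G *)
Definition is_G_integral (p : R) (eta : R -> Omega -> R) (t : R)
    (I : Omega -> R) : Prop :=
  [/\ jointly_measurable eta, measurable_fun setT I &
    exists2 h : nat -> step T, HG_approx p eta h &
      LG_norm p (I \- step_integral (h n) B t) @[n --> \oo] --> 0%E].

End G_expectation.

Section market.
Context {R : realType} {T : R}.
Local Notation Omega := (Omega T).
Variables (F : R -> set (set Omega)) (Q : set (probability Omega R)).

(* d gamma = r gamma dt, gamma_0 = 1 *)
Definition is_bond (r : R) (gamma : R -> R) : Prop :=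
  [/\ gamma 0 = 1, {within `[0, T], continuous gamma} &
      forall t : R, t \in `]0, T[ -> is_derive t 1 gamma (r * gamma t)].

(* dS = r S dt + S dB, S_0 = x0. As \int_0^t . dB is an element of L^1_G, here
   and below an equation between processes is read q.s. for each t. *)
Definition is_stock (r x0 : R) (S : R -> Omega -> R) : Prop :=
  forall t : R, t \in `[0, T] -> measurable_fun setT (S t) /\
    exists2 I, is_G_integral Q 1 S t I &
      qs Q [set w | S t w =
        x0 + \int[lebesgue_measure]_(u in `[0, t]) (r * S u w) + I w].

Definition portfolio_process (pi : R -> Omega -> R) : Prop :=
  adapted F pi /\ forall t : R, t \in `[0, T] -> LG Q 1 (pi t).

(* C_T < +oo is part of the type *)
Definition consumption_process (C : R -> Omega -> R) : Prop :=
  [/\ adapted F C, forall t : R, t \in `[0, T] -> LG Q 1 (C t) &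
    qs Q [set w |
      [/\ C 0 w = 0,
          forall t : R, t \in `[0, T] -> 0 <= C t w,
          forall s t : R, 0 <= s -> s <= t -> t <= T -> C s w <= C t w,
          forall t : R, 0 < t -> t < T -> C u w @[u --> t^'+] --> C t w &
          forall t : R, 0 < t -> t <= T -> cvg (C u w @[u --> t^'-])]]].

Variable gamma : R -> R.

Definition wealth_equation (y : R) (pi C X : R -> Omega -> R) : Prop :=
  forall t : R, t \in `[0, T] -> measurable_fun setT (X t) /\
    exists2 I,
      is_G_integral Q 1 (fun u w => (gamma u)^-1 * X u w * pi u w) t I &
      qs Q [set w | exists2 J,
        is_stieltjes (fun u => (gamma u)^-1) (C ^~ w) t J &
        (gamma t)^-1 * X t w = y - J + I w].

(* X is (a version of) X^{y, pi, C}: uniqueness is up to modification. *)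
Definition is_wealth_process (y : R) (pi C X : R -> Omega -> R) : Prop :=
  wealth_equation y pi C X /\
  forall X', wealth_equation y pi C X' ->
    forall t : R, t \in `[0, T] -> qs Q [set w | X' t w = X t w].

Definition admissible (y : R) (pi C : R -> Omega -> R) : Prop :=
  [/\ portfolio_process pi, consumption_process C &
    exists X, [/\ is_wealth_process y pi C X,
      HG Q 1 (fun t w => pi t w * X t w) &
      exists L : Omega -> R, [/\ LG Q 2 L, qs Q [set w | 0 <= L w] &
        qs Q [set w | forall t : R, t \in `[0, T] -> - L w <= X t w]]]].

End market.

(* Main.v *)
(* Discounted wealth at T is y + I, where I is a G-integral, and no consumption
   takes place; so I >= -y >= 0 for an arbitrage, and it suffices to show that
   a nonnegative G-integral vanishes a.s. under every prior P.

   I is the L1(P)-limit of sums X_n of terms xi_j (B_(t_(j+1)) - B_(t_j)), with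
   xi_j a locally Lipschitz function of finitely many values of the path up to
   time t_j.  These xi_j are unbounded, but since I >= 0 the negative part of
   X_n is integrable, and a discrete-time local martingale whose final value
   has integrable negative part is a martingale: E_P X_n = 0, hence E_P I = 0.

   The martingale property is only needed against bounded Lipschitz functions
   phi of finitely many past values.  Under the law of a stochastic integral it
   comes from step integrals with respect to W, by independence of Brownian
   increments.  It passes to weak limits since the increments of all these laws
   are bounded in L2: replacing B_t' - B_t by its clipping at level r costs
   O(1/r) uniformly, and the clipped expression is a bounded continuous function
   of the path. *)

Require Import Defs.
From HB Require Import structures.
From mathcomp Require Import all_boot all_order all_algebra.
From mathcomp Require Import all_classical all_reals all_analysis.
From mathcomp Require Import measurable_realfun.
From mathcomp Require Import ring lra.
Import Order.TTheory GRing.Theory Num.Theory.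
Import numFieldNormedType.Exports.
Local Open Scope classical_set_scope.
Local Open Scope ring_scope.

Set Implicit Arguments.
Unset Strict Implicit.
Unset Printing Implicit Defensive.

(** * Integration *)

(** The coefficients of the approximating sums have polynomial growth, whereas for a prior only a
    second-moment bound on increments is established; a direct computation of E_P X_n would require
    integrability of products of high powers of the path. Cutoffs that are Lipschitz in the past
    values take the place of these moments, and Fatou's lemma then recovers integrability from the
    control of the negative part. A prior that is only a weak limit comes with no volatility
    process. What passes to it is an upper bound on the integral of a bounded continuous function,
    so every fact about priors is first put in that form, and an equality is obtained by applying a
    bound to a functional and to its opposite. Uniformity over the laws rests on one number: every
    volatility is at most [su], so the step processes approximating it eventually have energy at
    most 2 su^2 T + 1. The factor 4 sqrt 2 in front of it is a crude bound on the second moment of a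
    normal law in units of its variance; any finite constant would serve. *)

Section integration.
Context d {X : measurableType d} {R : realType} (P : probability X R).
Implicit Types f g : X -> R.
Local Notation L1 f := (P.-integrable setT (EFin \o f)).

Lemma integrable_measurable f : L1 f -> measurable_fun setT f.
Proof. by move=> /(measurable_int P) /measurable_EFinP. Qed.

Lemma integrable_le f g : measurable_fun setT f -> L1 g ->
  (forall x, `|f x| <= g x) -> L1 f.
Proof.
move=> mf ig fg; apply: (le_integrable _ _ _ ig) => //; first exact/measurable_EFinP.
by move=> x _ /=; rewrite lee_fin (le_trans (fg x))// ler_norm.
Qed.

Lemma integrable_cst (k : R) : L1 (fun=> k).
Proof. exact: finite_measure_integrable_cst. Qed.

Lemma Rintegral_const (k : R) : \int[P]_x k = k.
Proof.
rewrite Rintegral_cst// -[RHS]mulr1; congr (k * _).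
exact: (congr1 fine (probability_setT P)).
Qed.

Lemma integrable_bounded f (K : R) : measurable_fun setT f ->
  (forall x, `|f x| <= K) -> L1 f.
Proof. by move=> mf fK; exact: (integrable_le mf (integrable_cst K)). Qed.

Lemma integrable_add f g : L1 f -> L1 g -> L1 (fun x => f x + g x).
Proof. by move=> hf hg; exact: (integrableD measurableT hf hg). Qed.

Lemma integrable_sub f g : L1 f -> L1 g -> L1 (fun x => f x - g x).
Proof. by move=> hf hg; exact: (integrableB measurableT hf hg). Qed.

Lemma integrable_scale (k : R) f : L1 f -> L1 (fun x => k * f x).
Proof. by move=> hf; exact: (integrableZl measurableT k hf). Qed.

Lemma integrable_abs f : L1 f -> L1 (fun x => `|f x|).
Proof. by move=> hf; exact: (integrable_norm hf). Qed.

Lemma integrable_mul_bounded f g (K : R) : measurable_fun setT f ->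
  (forall x, `|f x| <= K) -> L1 g -> L1 (fun x => f x * g x).
Proof.
move=> mf fK ig; apply: (integrable_le _ (integrable_scale K (integrable_abs ig))).
  by apply: measurable_funM => //; exact: integrable_measurable ig.
by move=> x; rewrite normrM ler_wpM2r.
Qed.

Lemma integrable_mul_sqr f g : measurable_fun setT f -> measurable_fun setT g ->
  L1 (fun x => f x ^+ 2) -> L1 (fun x => g x ^+ 2) -> L1 (fun x => f x * g x).
Proof.
move=> mf mg f2 g2; apply: (integrable_le _ (integrable_add f2 g2)).
  exact: measurable_funM.
move=> x; rewrite ler_norml; nra.
Qed.

Lemma integrable_sqr f : measurable_fun setT f ->
  L1 (fun x => f x ^+ 2) -> L1 f.
Proof.
move=> mf f2; apply: (integrable_le mf (integrable_add (integrable_cst 1) f2)).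
by move=> x; rewrite ler_norml; nra.
Qed.

Lemma Rintegral_EFin f : L1 f -> (\int[P]_x (f x)%:E)%E = (\int[P]_x f x)%:E.
Proof. by move=> fi; rewrite /Rintegral fineK//; exact: integrable_fin_num. Qed.

Lemma ge0_integrable_le f (K : R) : measurable_fun setT f ->
  (forall x, 0 <= f x) -> (\int[P]_x (f x)%:E <= K%:E)%E ->
  L1 f /\ \int[P]_x f x <= K.
Proof.
move=> mf f0 fK.
have fi : L1 f.
  apply/integrableP; split; first exact/measurable_EFinP.
  under eq_integral do rewrite /= ger0_norm//.
  exact: le_lt_trans fK (ltry _).
by split => //; rewrite -lee_fin -Rintegral_EFin.
Qed.

(** Fatou's lemma in the form suited to truncations, which reach their limit at each point after
    finitely many steps. The uniform bound on the integrals is what proves the limit integrable. *)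
Lemma fatou_bound (f_ : nat -> X -> R) f (K : R) :
  (forall n, L1 (f_ n)) -> (forall n x, 0 <= f_ n x) ->
  (forall x, \forall n \near \oo, f_ n x = f x) ->
  (forall n, \int[P]_x f_ n x <= K) ->
  L1 f /\ \int[P]_x f x <= K.
Proof.
move=> if_ f0 ff fK.
have cf x : (f_ n x)%:E @[n --> \oo] --> (f x)%:E.
  apply: (cvg_trans _ (@cvg_cst _ (f x)%:E nat \oo _)); apply: near_eq_cvg.
  by apply: filterS (ff x) => n ->.
have mf : measurable_fun setT f.
  apply/measurable_EFinP.
  apply: (@emeasurable_fun_cvg _ _ _ _ (fun n => EFin \o f_ n)).
    by move=> n; exact: measurable_int (if_ n).
  by move=> x _; exact: cf.
have f0' x : 0 <= f x by have [n _ /(_ n (leqnn n))/= <-] := ff x.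
apply: (@ge0_integrable_le f K mf f0').
have -> : (\int[P]_x (f x)%:E)%E =
    (\int[P]_x limn_einf (fun n => (f_ n x)%:E))%E.
  by apply: eq_integral => x _; have [-> _] := cvg_limn_einf_sup (cf x).
apply: (le_trans (@fatou _ _ _ P setT measurableT (fun n => EFin \o f_ n) _ _)).
- by move=> n; exact: measurable_int (if_ n).
- by move=> n x _; rewrite lee_fin.
rewrite limn_einf_lim; apply: lime_le; first exact: is_cvg_einfs.
apply: nearW => n; apply: (@le_trans _ _ (\int[P]_x (f_ n x)%:E)%E).
  by apply: ereal_inf_lbound; exists n => /=.
by rewrite Rintegral_EFin// lee_fin.
Qed.

Lemma dominated_eventually (f_ : nat -> X -> R) f g :
  (forall n, L1 (f_ n)) -> (forall n x, `|f_ n x| <= g x) -> L1 g ->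
  (forall x, \forall n \near \oo, f_ n x = f x) ->
  L1 f /\ \int[P]_x f_ n x @[n --> \oo] --> \int[P]_x f x.
Proof.
move=> if_ fg ig ff.
have cf x : (f_ n x)%:E @[n --> \oo] --> (f x)%:E.
  apply: (cvg_trans _ (@cvg_cst _ (f x)%:E nat \oo _)); apply: near_eq_cvg.
  by apply: filterS (ff x) => n ->.
have mf : measurable_fun setT (EFin \o f).
  apply: (@emeasurable_fun_cvg _ _ _ _ (fun n => EFin \o f_ n)).
    by move=> n; exact: measurable_int (if_ n).
  by move=> x _; exact: cf.
have [] := @dominated_convergence _ _ _ P setT measurableT
  (fun n => EFin \o f_ n) (EFin \o f) (EFin \o g) _ mf _ ig _.
- by move=> n; exact: measurable_int (if_ n).
- by apply: aeW => x _; exact: cf.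
- by apply: aeW => x n _; rewrite /= lee_fin.
move=> fi _ fcv; split => //; apply: fine_cvg.
by rewrite -Rintegral_EFin.
Qed.

End integration.

(** * Lipschitz cylinder functionals *)

Section cylinder_functionals.
Context {R : realType}.
Implicit Types (s : seq R) (f g : R -> R) (phi psi : (R -> R) -> R) (r t : R).

(* Functionals of a path depending only on its values at the times in [s].
   They are defined on all functions, not only on continuous paths, so that
   they can be evaluated at a step integral, some of whose paths may fail to
   be continuous. *)
Definition dist_on s f g : R := \sum_(u <- s) `|f u - g u|.

Definition size_on s f : R := \sum_(u <- s) `|f u|.

(** Boundedness is included so that the class is stable under products and its members are test
    functions for weak convergence. *)
Definition lip_on s phi : Prop := exists K : R,
  [/\ 0 <= K, forall f, `|phi f| <= K &
      forall f g, `|phi f - phi g| <= K * dist_on s f g].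

(** One constant serves as bound and as Lipschitz constant on each ball of [size_on]. This covers
    the functions of polynomial growth allowed in [Lip], and the class is stable under products. *)
Definition loclip_on s phi : Prop := forall r, exists K : R,
  0 <= K /\ forall f g, size_on s f <= r -> size_on s g <= r ->
    `|phi f| <= K /\ `|phi f - phi g| <= K * dist_on s f g.

Definition cutoff s r f : R := Num.max 0 (Num.min 1 (r + 1 - size_on s f)).

Lemma dist_on_ge0 s f g : 0 <= dist_on s f g.
Proof. by apply: sumr_ge0. Qed.

Lemma size_on_ge0 s f : 0 <= size_on s f.
Proof. by apply: sumr_ge0. Qed.

Lemma dist_on_cat s s' f g : dist_on (s ++ s') f g = dist_on s f g + dist_on s' f g.
Proof. exact: big_cat. Qed.

Lemma size_on_cat s s' f : size_on (s ++ s') f = size_on s f + size_on s' f.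
Proof. exact: big_cat. Qed.

Lemma size_on_mem s f u : u \in s -> `|f u| <= size_on s f.
Proof.
by move=> us; rewrite /size_on (big_rem u us)/= lerDl sumr_ge0.
Qed.

Lemma dist_on_mem s f g u : u \in s -> `|f u - g u| <= dist_on s f g.
Proof.
by move=> us; rewrite /dist_on (big_rem u us)/= lerDl sumr_ge0.
Qed.

Lemma size_on_lip s f g : `|size_on s f - size_on s g| <= dist_on s f g.
Proof.
rewrite /size_on /dist_on -sumrB; apply: (le_trans (ler_norm_sum _ _ _)).
by apply: ler_sum => u _; exact: ler_dist_dist.
Qed.

Lemma dist_onC s f g : dist_on s f g = dist_on s g f.
Proof. by apply: eq_bigr => u _; rewrite distrC. Qed.

Lemma loclip_on_catl s s' phi : loclip_on s phi -> loclip_on (s ++ s') phi.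
Proof.
move=> h r; have [K [K0 hK]] := h r; exists K; split => // f g.
rewrite !size_on_cat dist_on_cat => fr gr.
have [] := hK f g; first by have := size_on_ge0 s' f; lra.
  by have := size_on_ge0 s' g; lra.
move=> h1 h2; split => //; apply: (le_trans h2); rewrite ler_wpM2l//.
by rewrite lerDl dist_on_ge0.
Qed.

Lemma loclip_on_catr s s' phi : loclip_on s phi -> loclip_on (s' ++ s) phi.
Proof.
move=> h r; have [K [K0 hK]] := h r; exists K; split => // f g.
rewrite !size_on_cat dist_on_cat => fr gr.
have [] := hK f g; first by have := size_on_ge0 s' f; lra.
  by have := size_on_ge0 s' g; lra.
move=> h1 h2; split => //; apply: (le_trans h2); rewrite ler_wpM2l//.
by rewrite lerDr dist_on_ge0.
Qed.

Lemma loclip_on_cst s (k : R) : loclip_on s (fun=> k).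
Proof.
move=> r; exists `|k|; split => // f g _ _; split => //.
by rewrite subrr normr0 mulr_ge0// dist_on_ge0.
Qed.

Lemma loclip_on_eval s u : u \in s -> loclip_on s (fun f => f u).
Proof.
move=> us r; exists (1 + `|r|); split; first by rewrite addr_ge0.
move=> f g fr gr; have := size_on_mem f us; have := dist_on_mem f g us.
have := dist_on_ge0 s f g; have := ler_norm r; have := normr_ge0 r.
split; first lra.
by rewrite (le_trans (y := dist_on s f g))// ler_peMl//; lra.
Qed.

Lemma loclip_on_add s phi psi : loclip_on s phi -> loclip_on s psi ->
  loclip_on s (fun f => phi f + psi f).
Proof.
move=> h k r; have [K [K0 hK]] := h r; have [L [L0 kL]] := k r.
exists (K + L); split; first exact: addr_ge0.
move=> f g fr gr; have [h1 h2] := hK f g fr gr; have [k1 k2] := kL f g fr gr.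
split; first by rewrite (le_trans (ler_normD _ _))// lerD.
have -> : phi f + psi f - (phi g + psi g) = (phi f - phi g) + (psi f - psi g).
  by ring.
by rewrite (le_trans (ler_normD _ _))// mulrDl lerD.
Qed.

Lemma loclip_on_mul s phi psi : loclip_on s phi -> loclip_on s psi ->
  loclip_on s (fun f => phi f * psi f).
Proof.
move=> h k r; have [K [K0 hK]] := h r; have [L [L0 kL]] := k r.
exists (K * L + K * L); split; first by rewrite addr_ge0// mulr_ge0.
move=> f g fr gr; have [h1 h2] := hK f g fr gr; have [k1 k2] := kL f g fr gr.
have [h3 _] := hK g f gr fr.
split; first by rewrite normrM (le_trans (ler_pM _ _ h1 k1))// lerDl mulr_ge0.
have -> : phi f * psi f - phi g * psi g =
  (phi f - phi g) * psi f + phi g * (psi f - psi g) by ring.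
apply: (le_trans (ler_normD _ _)); rewrite !normrM mulrDl; apply: lerD.
  by rewrite mulrAC ler_pM.
by rewrite -mulrA ler_pM.
Qed.

Lemma loclip_on_comp s phi (h : R -> R) (M : R) : 0 <= M ->
  (forall x y, `|h x - h y| <= M * `|x - y|) ->
  loclip_on s phi -> loclip_on s (h \o phi).
Proof.
move=> M0 hM hphi r; have [K [K0 hK]] := hphi r.
exists (`|h 0| + M * K); split; first by rewrite addr_ge0// mulr_ge0.
move=> f g fr gr; have [h1 h2] := hK f g fr gr; split => /=.
  have -> : h (phi f) = h 0 + (h (phi f) - h 0) by rewrite addrC subrK.
  rewrite (le_trans (ler_normD _ _))// lerD2l (le_trans (hM _ _))//.
  by rewrite subr0 ler_wpM2l.
rewrite (le_trans (hM _ _))// mulrDl -mulrA.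
by rewrite -[leLHS]add0r lerD ?ler_wpM2l// mulr_ge0// dist_on_ge0.
Qed.

Lemma cutoff_ge0 s r f : 0 <= cutoff s r f.
Proof. by rewrite /cutoff le_max lexx. Qed.

Lemma cutoff_le1 s r f : cutoff s r f <= 1.
Proof. by rewrite /cutoff ge_max ler01 ge_min lexx. Qed.

Lemma cutoff_lip s r f g : `|cutoff s r f - cutoff s r g| <= dist_on s f g.
Proof.
have := size_on_lip s f g; rewrite /cutoff.
set a := size_on s f; set b := size_on s g; set D := dist_on s f g.
rewrite !ler_norml => /andP[h1 h2].
case: (leP 1 (r + 1 - a)) => c1; case: (leP 1 (r + 1 - b)) => c2;
  rewrite ?(max_r ler01).
- by apply/andP; split; lra.
- by case: (leP 0 (r + 1 - b)) => c3; apply/andP; split; lra.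
- by case: (leP 0 (r + 1 - a)) => c3; apply/andP; split; lra.
- by case: (leP 0 (r + 1 - a)) => c3; case: (leP 0 (r + 1 - b)) => c4;
    apply/andP; split; lra.
Qed.

Lemma cutoff_out s r f : r + 1 < size_on s f -> cutoff s r f = 0.
Proof.
move=> h; rewrite /cutoff; apply/eqP; rewrite eq_le ge_max lexx/= ge_min.
by apply/andP; split; [apply/orP; right; lra|rewrite le_max lexx].
Qed.

Lemma cutoff_in s r f : size_on s f <= r -> cutoff s r f = 1.
Proof.
move=> h; rewrite /cutoff min_l; last lra.
by rewrite max_r.
Qed.

Lemma cutoff_eventually s f : \forall n \near \oo, cutoff s n%:R f = 1.
Proof. by near=> n; apply: cutoff_in; near: n; exact: nbhs_infty_ger. Unshelve. all: by end_near. Qed.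

(** The cutoff vanishes beyond size [r + 1], so the constant [K] of [phi] on that ball is enough. It
    is doubled because both factors vary: the cutoff is 1-Lipschitz against a value of [phi] at most
    [K], and [phi] is [K]-Lipschitz against a cutoff at most 1. *)
Lemma cutoff_lip_on s r phi : loclip_on s phi ->
  lip_on s (fun f => cutoff s r f * phi f).
Proof.
move=> h; have [K [K0 hK]] := h (r + 1).
have bd f : `|cutoff s r f * phi f| <= K.
  rewrite normrM ger0_norm ?cutoff_ge0//.
  have [fr|fr] := leP (size_on s f) (r + 1).
    have [h1 _] := hK f f fr fr.
    by rewrite (le_trans _ h1)// ler_piMl// cutoff_le1.
  by rewrite cutoff_out// mul0r.
exists (K + K); split; first exact: addr_ge0.
  by move=> f; rewrite (le_trans (bd f))// lerDl.
move=> f g.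
wlog fg : f g / size_on s f <= size_on s g.
  move=> hw; have [fg|fg] := leP (size_on s f) (size_on s g); first exact: hw.
  by rewrite distrC dist_onC; apply: hw; exact: ltW.
have [gr|gr] := leP (size_on s g) (r + 1).
  have fr := le_trans fg gr.
  have [f1 fg2] := hK f g fr gr; have [g1 _] := hK g f gr fr.
  have -> : cutoff s r f * phi f - cutoff s r g * phi g =
    (cutoff s r f - cutoff s r g) * phi f + cutoff s r g * (phi f - phi g) by ring.
  apply: (le_trans (ler_normD _ _)); rewrite [leRHS]mulrDl.
  apply: lerD; rewrite normrM.
    by rewrite mulrC ler_pM// cutoff_lip.
  rewrite (le_trans _ fg2)// ger0_norm ?cutoff_ge0//.
  by rewrite ler_piMl// cutoff_le1.
(* With [g] outside the support of the cutoff, the value of the cutoff at [f] is itself a difference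
   of cutoff values, hence at most [dist_on s f g]. *)
rewrite (cutoff_out gr) mul0r subr0 normrM.
have [fr|fr] := leP (size_on s f) (r + 1); last first.
  by rewrite (cutoff_out fr) normr0 mul0r mulr_ge0// ?dist_on_ge0// addr_ge0.
have [f1 _] := hK f f fr fr.
have := cutoff_lip s r f g; rewrite (cutoff_out gr) subr0 => cl.
rewrite mulrC (le_trans (ler_pM _ _ f1 cl))//.
by rewrite mulrDl lerDl mulr_ge0// dist_on_ge0.
Qed.

Lemma loclip_cutoff s r : loclip_on s (cutoff s r).
Proof.
move=> r'; exists 1; split => // f g _ _; rewrite mul1r cutoff_lip.
by rewrite ger0_norm ?cutoff_ge0// cutoff_le1.
Qed.

Lemma lip_on_loclip s phi : lip_on s phi -> loclip_on s phi.
Proof. by move=> [K [K0 hb hl]] r; exists K; split. Qed.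

End cylinder_functionals.

(** * Measurability of cylinder functionals of a process *)

Section cylinder_measurability.
Context d {X : measurableType d} {R : realType}.
Implicit Types (s : seq R) (phi : (R -> R) -> R) (Y : R -> X -> R).

Lemma measurable_dist_on s Y (g : R -> R) :
  (forall u, u \in s -> measurable_fun setT (Y u)) ->
  measurable_fun setT (fun x => dist_on s (Y ^~ x) g).
Proof.
elim: s => [|u s IH] mY.
  rewrite [X in measurable_fun _ X](_ : _ = fun=> 0)//.
  by apply/funext => x; rewrite /dist_on big_nil.
rewrite [X in measurable_fun _ X](_ : _ =
  fun x => `|Y u x - g u| + dist_on s (Y ^~ x) g); last first.
  by apply/funext => x; rewrite /dist_on big_cons.
apply: measurable_funD.
  apply: measurableT_comp => //; apply: measurable_funB => //.
  by apply: mY; rewrite mem_head.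
by apply: IH => v vs; apply: mY; rewrite inE vs orbT.
Qed.

Let rational_path s (l : seq rat) : R -> R :=
  fun u => ratr (nth 0 l (index u s)).

Let rational_path_dense s (f : R -> R) (e : R) : 0 < e ->
  exists l, dist_on s f (rational_path s l) < e.
Proof.
(* The successor keeps the denominator positive for an empty list and makes the final inequality
   strict. *)
move=> e0; pose n : R := (size s).+1%:R.
have n0 : 0 < n by rewrite ltr0n.
have ex u : exists q : rat, `|f u - ratr q| < e / n.
  have [q] : exists q : rat, ratr q \in `]f u - e / n, f u + e / n[.
    by apply: rat_in_itvoo; rewrite ltrBlDr -addrA ltrDl addr_gt0// divr_gt0.
  rewrite in_itv/= => /andP[h1 h2]; exists q.
  by rewrite distrC ltr_distl h1.
pose q u := sval (cid (ex u)).
exists [seq q u | u <- s].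
apply: (@le_lt_trans _ _ (\sum_(u <- s) (e / n))).
  rewrite /dist_on big_seq [leRHS]big_seq; apply: ler_sum => u us.
  rewrite /rational_path (nth_map 0) ?index_mem// nth_index//.
  exact/ltW/(svalP (cid (ex u))).
rewrite big_const_seq count_predT iter_addr_0 -[ltLHS]mulr_natr mulrAC.
by rewrite ltr_pdivrMr// ltr_pM2l// ltr_nat ltnSn.
Qed.

(* {phi o Y < a} is the union, over the countably many rational paths q, of the
   sets {phi q + K dist(Y, q) < a}. *)
Lemma measurable_lip_on s phi Y : lip_on s phi ->
  (forall u, u \in s -> measurable_fun setT (Y u)) ->
  measurable_fun setT (fun x => phi (Y ^~ x)).
Proof.
move=> [K [K0 _ Kl]] mY.
move=> mT; apply: (measurability _ (RGenInftyO.measurableE R)) => //.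
move=> _ [_ [a ->] <-]; rewrite setTI.
pose q n := rational_path s (odflt [::] (unpickle n)).
rewrite [X in measurable X](_ : _ = \bigcup_n
  [set x | phi (q n) + K * dist_on s (Y ^~ x) (q n) < a]); last first.
  apply/seteqP; split => x /=; rewrite in_itv/=.
    move=> ltx.
    (* At a rational path within distance D of the given one, phi + K D exceeds the value at the
       given path by at most 2 K D; the added 1 covers [K = 0]. *)
    have e0 : 0 < (a - phi (Y ^~ x)) / (K + K + 1).
      by rewrite divr_gt0//; lra.
    have [l hl] := rational_path_dense s (Y ^~ x) e0.
    exists (pickle l) => //=; rewrite /q pickleK/=.
    move: hl; set D := dist_on _ _ _ => hl.
    have D0 : 0 <= D by exact: dist_on_ge0.
    have := Kl (Y ^~ x) (rational_path s l); rewrite -/D ler_norml => /andP[h1 _].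
    move: hl; rewrite ltr_pdivlMr; last lra.
    by nra.
  move=> [n _ /=]; apply: le_lt_trans.
  have := Kl (Y ^~ x) (q n); rewrite ler_norml => /andP[_ h1].
  by lra.
apply: bigcup_measurable => n _.
rewrite [X in measurable X](_ : _ =
  (fun x => phi (q n) + K * dist_on s (Y ^~ x) (q n)) @^-1` `]-oo, a[); last first.
  by apply/seteqP; split => x /=; rewrite in_itv.
rewrite -[X in measurable X]setTI.
have /(_ measurableT) : measurable_fun setT
    (fun x => phi (q n) + K * dist_on s (Y ^~ x) (q n)).
  apply: measurable_funD => //; apply: measurable_funM => //.
  exact: measurable_dist_on.
by apply; exact: measurable_itv.
Qed.

Lemma measurable_loclip_on s phi Y : loclip_on s phi ->
  (forall u, u \in s -> measurable_fun setT (Y u)) ->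
  measurable_fun setT (fun x => phi (Y ^~ x)).
Proof.
move=> hphi mY.
apply: (@measurable_fun_cvg _ _ _ _
  (fun n x => cutoff s n%:R (Y ^~ x) * phi (Y ^~ x))).
  move=> n; exact: (measurable_lip_on (cutoff_lip_on n%:R hphi)).
move=> x _; apply: (cvg_trans _ (@cvg_cst _ (phi (Y ^~ x)) nat \oo _)).
apply: near_eq_cvg; apply: filterS (cutoff_eventually s (Y ^~ x)) => n ->.
by rewrite mul1r.
Qed.

End cylinder_measurability.

(** * Independence and Gaussian moments *)

Section independence.
Context d {X : measurableType d} {R : realType} (P : probability X R).
Local Notation L1 f := (P.-integrable setT (EFin \o f)).
Variables (Z I : X -> R).
Hypotheses (mZ : measurable_fun setT Z) (mI : measurable_fun setT I).
Hypothesis ZI : forall D E : set R, measurable D -> measurable E ->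
  P (Z @^-1` D `&` I @^-1` E) = (P (Z @^-1` D) * P (I @^-1` E))%E.

(** Independence says that the law of the pair agrees with the product of the marginal laws on
    rectangles, hence everywhere; Tonelli's theorem then factors the integral. *)
Lemma indep_ge0_integral (f h : R -> R) :
  measurable_fun setT f -> measurable_fun setT h ->
  (forall x, 0 <= f x) -> (forall x, 0 <= h x) ->
  (\int[P]_x (f (Z x) * h (I x))%:E =
   (\int[P]_x (f (Z x))%:E) * \int[P]_x (h (I x))%:E)%E.
Proof.
move=> mf mh f0 h0.
pose mZ' := isMeasurableFun.Build _ _ _ _ _ mZ.
pose Z' : {mfun _ >-> _} := HB.pack Z mZ'.
pose mI' := isMeasurableFun.Build _ _ _ _ _ mI.
pose I' : {mfun _ >-> _} := HB.pack I mI'.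
have mZI : measurable_fun setT (fun x => (Z x, I x)).
  exact: measurable_fun_pair.
pose mZI' := isMeasurableFun.Build _ _ _ _ _ mZI.
pose ZI' : {mfun _ >-> _} := HB.pack (fun x => (Z x, I x)) mZI'.
pose F := fun z : R * R => (f z.1 * h z.2)%:E.
have mF : measurable_fun setT F.
  by apply/measurable_EFinP; apply: measurable_funM; exact: measurableT_comp.
have F0 z : (0 <= F z)%E by rewrite lee_fin mulr_ge0.
transitivity (\int[distribution P ZI']_z F z)%E.
  by rewrite ge0_integral_pushforward.
rewrite (eq_measure_integral (distribution P Z' \x distribution P I')%E); last first.
  by move=> A mA _; apply/esym/product_measure_unique.
rewrite fubini_tonelli1//.
transitivity (\int[distribution P Z']_z ((f z)%:E * \int[P]_x (h (I x))%:E))%E.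
  apply: eq_integral => z _; rewrite /fubini_F.
  transitivity (\int[distribution P I']_y ((f z)%:E * (h y)%:E))%E => //.
  rewrite ge0_integralZl//=; [|exact/measurable_EFinP
    |by move=> y _; rewrite lee_fin|by rewrite lee_fin].
  rewrite ge0_integral_pushforward//=; [exact/measurable_EFinP|].
  by move=> y _; rewrite lee_fin.
rewrite ge0_integralZr//; [|exact/measurable_EFinP|by move=> z _; rewrite lee_fin
  |by apply: integral_ge0 => x _; rewrite lee_fin].
rewrite ge0_integral_pushforward//=; [exact/measurable_EFinP|].
by move=> y _; rewrite lee_fin.
Qed.

Lemma indep_integrable : L1 Z -> L1 I -> L1 (fun x => Z x * I x).
Proof.
move=> iZ iI; apply/integrableP; split.
  by apply/measurable_EFinP; exact: measurable_funM.
under eq_integral do rewrite /= normrM.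
rewrite (indep_ge0_integral (f := fun x => `|x|) (h := fun x => `|x|))//.
rewrite (Rintegral_EFin (integrable_abs iZ)) (Rintegral_EFin (integrable_abs iI)).
by rewrite -EFinM ltry.
Qed.

(** The nonnegative case, applied to the four products of positive and negative parts. *)
Lemma indep_Rintegral_mul : L1 Z -> L1 I ->
  \int[P]_x (Z x * I x) = (\int[P]_x Z x) * (\int[P]_x I x).
Proof.
move=> iZ iI.
pose p (x : R) : R := Num.max x 0; pose n (x : R) : R := Num.max (- x) 0.
have mp : measurable_fun setT p by apply: measurable_maxr.
have mn : measurable_fun setT n by apply: measurable_maxr.
have p0 x : 0 <= p x by rewrite /p le_max lexx orbT.
have n0 x : 0 <= n x by rewrite /n le_max lexx orbT.
have pn x : x = p x - n x.
  by rewrite /p /n; case: (leP x 0); case: (leP (- x) 0); lra.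
have pl x : `|p x| <= `|x|.
  by rewrite ger0_norm// /p ge_max ler_norm normr_ge0.
have nl x : `|n x| <= `|x|.
  by rewrite ger0_norm// /n ge_max normr_ge0 -normrN ler_norm.
have ip (Y : X -> R) : L1 Y -> L1 (p \o Y).
  move=> iY; apply: (integrable_le _ (integrable_abs iY)).
    by apply: measurableT_comp => //; exact: integrable_measurable iY.
  by move=> x; exact: pl.
have inn (Y : X -> R) : L1 Y -> L1 (n \o Y).
  move=> iY; apply: (integrable_le _ (integrable_abs iY)).
    by apply: measurableT_comp => //; exact: integrable_measurable iY.
  by move=> x; exact: nl.
have key (f h : R -> R) : measurable_fun setT f -> measurable_fun setT h ->
  (forall x, 0 <= f x) -> (forall x, 0 <= h x) ->
  L1 (f \o Z) -> L1 (h \o I) ->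
  L1 (fun x => f (Z x) * h (I x)) /\
  \int[P]_x (f (Z x) * h (I x)) = (\int[P]_x f (Z x)) * (\int[P]_x h (I x)).
  move=> mf mh f0 h0 iF iH.
  have E := indep_ge0_integral mf mh f0 h0.
  rewrite (Rintegral_EFin iF) (Rintegral_EFin iH) -EFinM in E.
  split; last by rewrite /Rintegral E.
  apply/integrableP; split.
    by apply/measurable_EFinP; apply: measurable_funM; exact: measurableT_comp.
  under eq_integral do rewrite /= ger0_norm ?mulr_ge0//.
  by rewrite E ltry.
have [i1 e1] := key p p mp mp p0 p0 (ip _ iZ) (ip _ iI).
have [i2 e2] := key p n mp mn p0 n0 (ip _ iZ) (inn _ iI).
have [i3 e3] := key n p mn mp n0 p0 (inn _ iZ) (ip _ iI).
have [i4 e4] := key n n mn mn n0 n0 (inn _ iZ) (inn _ iI).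
transitivity (\int[P]_x ((p (Z x) * p (I x) - p (Z x) * n (I x)) -
                        (n (Z x) * p (I x) - n (Z x) * n (I x)))).
  apply: eq_Rintegral => x _.
  by rewrite {1}(pn (Z x)) {1}(pn (I x)); ring.
rewrite !RintegralB//; [|exact: integrable_sub..].
rewrite e1 e2 e3 e4.
have dec (Y : X -> R) : L1 Y ->
    \int[P]_x Y x = (\int[P]_x p (Y x)) - \int[P]_x n (Y x).
  move=> iY; rewrite -RintegralB//; [|exact: ip|exact: inn].
  by apply: eq_Rintegral => x _; exact: pn.
by rewrite (dec _ iZ) (dec _ iI); ring.
Qed.

End independence.

(** * Mean and second moment of a centred normal law *)

Section gaussian_moments.
Context {R : realType} (s : R).
Hypothesis s0 : 0 < s.
Local Notation mu := (@lebesgue_measure R).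
Local Notation nu := (normal_prob 0 s).
Local Notation pdf := (normal_pdf 0 s).

(** Change of variables is available for the Radon-Nikodym derivative, which is identified with the
    normal density almost everywhere because both have the same integral over every measurable
    set. *)
Lemma ge0_integral_normal_prob (f : R -> R) :
  measurable_fun setT f -> (forall x, 0 <= f x) ->
  (\int[nu]_x (f x)%:E = \int[mu]_x (f x * pdf x)%:E)%E.
Proof.
move=> mf f0.
have dom := normal_prob_dominates 0 s.
rewrite -(Radon_Nikodym_SigmaFinite.change_of_variables dom)//; last first.
  exact/measurable_EFinP.
have iRN := Radon_Nikodym_SigmaFinite.f_integrable dom.
apply: ae_eq_integral => //.
- apply: emeasurable_funM; first exact/measurable_EFinP.
  exact: measurable_int iRN.
- apply/measurable_EFinP; apply: measurable_funM => //.
  exact: measurable_normal_pdf.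
- under [X in ae_eq _ _ _ X]eq_fun do rewrite EFinM.
  apply: ae_eqe_mul2l; apply: integral_ae_eq => //.
  + by apply/measurable_EFinP; exact: measurable_normal_pdf.
  + by move=> E _ mE; rewrite -Radon_Nikodym_SigmaFinite.f_integral.
Qed.

Lemma ge0_integral_opp (f : R -> R) :
  measurable_fun setT f -> (forall x, 0 <= f x) ->
  (\int[mu]_x (f (- x))%:E = \int[mu]_x (f x)%:E)%E.
Proof.
move=> mf f0.
transitivity (\int[pushforward mu (-%R : _ -> measurableTypeR R)]_x (f x)%:E)%E.
  rewrite ge0_integral_pushforward//=; [exact/measurable_EFinP|].
  by move=> y _; rewrite lee_fin.
by apply: eq_measure_integral => A mA _; exact: lebesgue_measureN.
Qed.

Lemma normal_pdf_even x : pdf (- x) = pdf x.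
Proof.
rewrite normal_pdfE ?gt_eqF// /normal_fun !subr0.
by rewrite sqrrN.
Qed.

Let c : R := Num.sqrt 2.

(* x^2 / (4 s^2) <= exp (x^2 / (4 s^2)), and the normal density of standard
   deviation s times this exponential is sqrt 2 times that of standard
   deviation sqrt 2 s. *)
Lemma normal_second_moment :
  (\int[nu]_x (x ^+ 2)%:E <= (4 * c * s ^+ 2)%:E)%E.
Proof.
rewrite (ge0_integral_normal_prob (f := fun x => x ^+ 2)); last 2 first.
- exact: exprn_measurable.
- by move=> x; exact: sqr_ge0.
have c0 : 0 < c by rewrite sqrtr_gt0.
have c2 : c ^+ 2 = 2 by rewrite sqr_sqrtr.
have cs0 : 0 < c * s by rewrite mulr_gt0.
rewrite -[leRHS]mule1 -(integral_normal_pdf 0 (c * s)) -ge0_integralZl//; last 3 first.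
- by apply/measurable_EFinP; exact: measurable_normal_pdf.
- by move=> x _; rewrite lee_fin normal_pdf_ge0.
- by rewrite lee_fin !mulr_ge0// ?sqr_ge0// ltW.
apply: ge0_le_integral => //.
- by move=> x _; rewrite lee_fin mulr_ge0 ?sqr_ge0 ?normal_pdf_ge0.
- apply/measurable_EFinP; apply: measurable_funM.
    exact: exprn_measurable.
  exact: measurable_normal_pdf.
- apply/measurable_EFinP; apply: measurable_funM => //.
  exact: measurable_normal_pdf.
move=> x _; rewrite -EFinM lee_fin.
rewrite !normal_pdfE ?gt_eqF// /normal_fun !subr0.
set q := x ^+ 2 / (4 * s ^+ 2).
have s2 : 0 < s ^+ 2 by rewrite exprn_gt0.
have -> : - x ^+ 2 / (s ^+ 2 *+ 2) = - q - q.
  by rewrite /q; field; rewrite gt_eqF.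
have -> : - x ^+ 2 / ((c * s) ^+ 2 *+ 2) = - q.
  by rewrite /q exprMn c2; field; rewrite gt_eqF.
have -> : normal_peak (c * s) = c^-1 * normal_peak s.
  rewrite /normal_peak -invfM; congr (_^-1).
  rewrite exprMn -mulrA -mulrnAr sqrtrM ?sqr_ge0// sqrtr_sqr ger0_norm//.
  exact: ltW.
have -> : x ^+ 2 = 4 * s ^+ 2 * q.
  by rewrite /q; field; rewrite gt_eqF.
have qe : q * expR (- q) <= 1.
  have := expR_ge1Dx q; rewrite -(ler_pM2r (expR_gt0 (- q))) -expRD subrr expR0.
  by have := expR_gt0 (- q); nra.
rewrite expRD.
have -> : 4 * c * s ^+ 2 * (c^-1 * normal_peak s * expR (- q)) =
  4 * s ^+ 2 * normal_peak s * expR (- q).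
  by field; rewrite gt_eqF.
have -> : 4 * s ^+ 2 * q * (normal_peak s * (expR (- q) * expR (- q))) =
  (4 * s ^+ 2 * normal_peak s * expR (- q)) * (q * expR (- q)) by ring.
by rewrite ler_piMr// !mulr_ge0// ?expR_ge0 ?normal_peak_ge0 ?(ltW s0).
Qed.

Lemma integrable_normal_sqr : nu.-integrable setT (EFin \o (fun x : R => x ^+ 2)).
Proof.
by have [] := ge0_integrable_le (P := nu) (exprn_measurable 2)
  (fun x => sqr_ge0 x) normal_second_moment.
Qed.

Lemma integrable_normal_id : nu.-integrable setT (EFin \o (fun x : R => x)).
Proof. by apply: integrable_sqr => //; exact: integrable_normal_sqr. Qed.

(** Reflection preserves the density and exchanges the positive and negative parts of the identity,
    so their integrals, finite by the second moment, cancel. *)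
Lemma normal_mean : \int[nu]_x x = 0.
Proof.
pose p (x : R) : R := Num.max x 0; pose n (x : R) : R := Num.max (- x) 0.
have mp : measurable_fun setT p by apply: measurable_maxr.
have mn : measurable_fun setT n by apply: measurable_maxr.
have p0 x : 0 <= p x by rewrite /p le_max lexx orbT.
have n0 x : 0 <= n x by rewrite /n le_max lexx orbT.
have pn x : x = p x - n x.
  by rewrite /p /n; case: (leP x 0); case: (leP (- x) 0); lra.
have ia := integrable_abs integrable_normal_id.
have ip : nu.-integrable setT (EFin \o p).
  apply: (integrable_le (P := nu) mp ia) => x.
  by rewrite ger0_norm// /p ge_max ler_norm normr_ge0.
have inn : nu.-integrable setT (EFin \o n).
  apply: (integrable_le (P := nu) mn ia) => x.
  by rewrite ger0_norm// /n ge_max normr_ge0 -normrN ler_norm.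
transitivity (\int[nu]_x (p x - n x)).
  by apply: eq_Rintegral => x _; exact: pn.
rewrite RintegralB// /Rintegral !ge0_integral_normal_prob//.
rewrite -[X in fine X - _](ge0_integral_opp (f := fun x => p x * pdf x)).
- apply/eqP; rewrite subr_eq0; apply/eqP; congr fine.
  by apply: eq_integral => x _; rewrite normal_pdf_even.
- by apply: measurable_funM => //; exact: measurable_normal_pdf.
- by move=> x; rewrite mulr_ge0 ?normal_pdf_ge0.
Qed.

End gaussian_moments.

(** * Brownian increments and step integrals *)

Section brownian_increments.
Context {R : realType} {T : R} (P0 : probability (Omega T) R).
Variable W : R -> Omega T -> R.
Hypothesis BW : brownian_motion P0 W.
Local Notation L1 f := (P0.-integrable setT (EFin \o f)).

Let gen (t : R) : set (set (Omega T)) :=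
  generated_past W t `|` [set N | measurable N /\ P0 N = 0%E].

(** Phrased as measurability for the sigma-algebra generated by [gen t], so that the stability of
    measurable functions under sums and products applies to adapted variables as it stands. *)
Definition past_measurable (t : R) (X : Omega T -> R) : Prop :=
  measurable_fun (setT : set (g_sigma_algebraType (gen t))) X.

Lemma brownian_measurable t : 0 <= t <= T -> measurable_fun setT (W t).
Proof. by move=> tT; case: BW => h _ _ _; apply: h; rewrite in_itv. Qed.

Lemma generated_past_measurable t A : t <= T ->
  generated_past W t A -> measurable A.
Proof.
move=> tT; apply: smallest_sub; first exact: sigma_algebra_measurable.
move=> B [s /= st [D mD <-]]; apply: brownian_measurable => //.
by move: st; rewrite in_itv/= => /andP[-> h]/=; exact: le_trans h tT.
Qed.

Lemma filtration_measurable t A : t <= T ->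
  filtration P0 W t A -> measurable A.
Proof.
move=> tT; apply: smallest_sub; first exact: sigma_algebra_measurable.
by move=> B [gB|[]//]; exact: generated_past_measurable gB.
Qed.

Lemma past_measurableP t X : past_measurable t X <->
  (forall A : set R, measurable A -> filtration P0 W t (X @^-1` A)).
Proof.
split=> [h A mA|h _ A mA].
  by have := h measurableT A mA; rewrite setTI.
by rewrite setTI; exact: h.
Qed.

Lemma past_measurableW t X : t <= T -> past_measurable t X ->
  measurable_fun setT X.
Proof.
move=> tT /past_measurableP h _ A mA; rewrite setTI.
exact: filtration_measurable (h A mA).
Qed.

Lemma generated_past_mono s t : s <= t ->
  generated_past W s `<=` generated_past W t.
Proof.
move=> st; apply: sub_sigma_algebra2 => A [u us hA]; exists u => //.
by move: us; rewrite /= !in_itv/= => /andP[->/= h]; exact: le_trans h st.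
Qed.

Lemma past_measurable_mono s t X : s <= t ->
  past_measurable s X -> past_measurable t X.
Proof.
move=> st /past_measurableP h; apply/past_measurableP => A mA.
move: (h A mA); apply: sub_sigma_algebra2 => B [hB|hB]; [left|by right].
exact: generated_past_mono hB.
Qed.

Lemma past_measurable_brownian s t : 0 <= s <= t -> past_measurable t (W s).
Proof.
move=> st; apply/past_measurableP => A mA; apply: sub_sigma_algebra; left.
apply: sub_sigma_algebra; exists s; first by rewrite /= in_itv.
by exists A => //; rewrite setTI.
Qed.

(* Every event of the filtration coincides, up to a null set, with an event of
   the past generated by W, so that adding null sets keeps independence. *)
Lemma filtration_generated_past t A : filtration P0 W t A ->
  exists A', [/\ generated_past W t A', P0.-negligible (A `\` A') &
                 P0.-negligible (A' `\` A)].
Proof.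
move: A; apply: smallest_sub.
  split.
  - exists set0; rewrite !set0D; split; [|exact: negligible_set0..].
    exact: sigma_algebra0.
  - move=> A [A' [gA' h1 h2]]; exists (~` A').
    by split; [exact: sigma_algebraC|rewrite setTD setDE setCK setIC -setDE..].
  - move=> A hA.
    have /choice[A' hA'] := hA.
    exists (\bigcup_n A' n); split.
    + by apply: sigma_algebra_bigcup => n; case: (hA' n).
    + apply: (negligibleS (A := \bigcup_n (A n `\` A' n))).
        move=> w [[n _ Anw] nA]; exists n => //; split => // A'n.
        by apply: nA; exists n.
      by apply: negligible_bigcup => n; case: (hA' n).
    + apply: (negligibleS (A := \bigcup_n (A' n `\` A n))).
        move=> w [[n _ Anw] nA]; exists n => //; split => // A'n.
        by apply: nA; exists n.
      by apply: negligible_bigcup => n; case: (hA' n).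
move=> A [gA|[mA A0]].
  by exists A; rewrite setDv; split => //; exact: negligible_set0.
exists set0; rewrite setD0 set0D; split; [exact: sigma_algebra0| |exact: negligible_set0].
exact/negligibleP.
Qed.

Let negligible_diff_measure (A A' : set (Omega T)) :
  measurable A -> measurable A' ->
  P0.-negligible (A `\` A') -> P0.-negligible (A' `\` A) -> P0 A = P0 A'.
Proof.
move=> mA mA' /(measure_negligible (measurableD mA mA')) h1.
move=> /(measure_negligible (measurableD mA' mA)) h2.
rewrite (measureDI P0 mA mA') (measureDI P0 mA' mA) setIC.
by congr (_ + _)%E; rewrite ?h1 ?h2.
Qed.

Lemma filtration_independent s t A (D : set R) : 0 <= s -> s < t -> t <= T ->
  filtration P0 W s A -> measurable D ->
  P0 (A `&` (W t \- W s) @^-1` D) = (P0 A * P0 ((W t \- W s)%R @^-1` D))%E.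
Proof.
move=> s0 st tT FA mD.
have sT : s <= T by exact: le_trans (ltW st) tT.
have mA := filtration_measurable sT FA.
have [A' [gA' h1 h2]] := filtration_generated_past FA.
have mA' := generated_past_measurable sT gA'.
have mI : measurable ((W t \- W s) @^-1` D).
  rewrite -[X in measurable X]setTI; apply: measurable_funB => //.
    by apply: brownian_measurable; rewrite tT (le_trans s0 (ltW st)).
  by apply: brownian_measurable; rewrite s0.
rewrite (negligible_diff_measure mA mA' h1 h2).
rewrite (negligible_diff_measure (measurableI _ _ mA mI) (measurableI _ _ mA' mI)).
- by case: BW => _ _ _; apply.
- by apply: negligibleS h1 => w [[Aw Iw] nAI]; split => // A'w; apply: nAI.
- by apply: negligibleS h2 => w [[Aw Iw] nAI]; split => // A'w; apply: nAI.
Qed.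

Lemma brownian_increment_moments s t : 0 <= s -> s < t -> t <= T ->
  [/\ L1 (W t \- W s), L1 (fun w => (W t w - W s w) ^+ 2),
      \int[P0]_w (W t w - W s w) = 0 &
      \int[P0]_w (W t w - W s w) ^+ 2 <= 4 * Num.sqrt 2 * (t - s)].
Proof.
move=> s0 st tT.
have sT : s <= T by exact: le_trans (ltW st) tT.
have mI : measurable_fun setT (W t \- W s).
  apply: measurable_funB.
    by apply: brownian_measurable; rewrite tT (le_trans s0 (ltW st)).
  by apply: brownian_measurable; rewrite s0.
pose sd := Num.sqrt (t - s).
have sd0 : 0 < sd by rewrite sqrtr_gt0 subr_gt0.
have sd2 : sd ^+ 2 = t - s by rewrite sqr_sqrtr// subr_ge0 ltW.
have mIR : @measurable_fun _ _ _ (measurableTypeR R) setT (W t \- W s) by exact: mI.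
pose mI' := isMeasurableFun.Build _ _ _ _ _ mIR.
pose I' : {mfun _ >-> measurableTypeR R} := HB.pack (W t \- W s) mI'.
have law (f : R -> R) : measurable_fun setT f -> (forall x, 0 <= f x) ->
    (\int[P0]_w (f (W t w - W s w))%:E = \int[normal_prob 0 sd]_x (f x)%:E)%E.
  move=> mf f0.
  transitivity (\int[distribution P0 I']_x (f x)%:E)%E.
    rewrite ge0_integral_pushforward//=; [exact/measurable_EFinP|].
    by move=> y _; rewrite lee_fin.
  by apply: eq_measure_integral => A mA _; case: BW => _ _ + _; apply.
have [i2 b2] : L1 (fun w => (W t w - W s w) ^+ 2) /\
    \int[P0]_w (W t w - W s w) ^+ 2 <= 4 * Num.sqrt 2 * (t - s).
  apply: ge0_integrable_le.
  - exact: measurable_funX.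
  - by move=> w; exact: sqr_ge0.
  - rewrite (law (fun x => x ^+ 2)); [|exact: exprn_measurable|
      by move=> x; exact: sqr_ge0].
    by rewrite -sd2; exact: normal_second_moment.
have i1 : L1 (W t \- W s) by exact: integrable_sqr.
split => //.
transitivity (\int[normal_prob 0 sd]_x x); last exact: normal_mean.
have ii : (pushforward P0 I').-integrable setT (EFin \o (fun x : R => x)).
  by apply: integrable_pushforward => //; exact/measurable_EFinP.
transitivity (\int[distribution P0 I']_x x).
  by rewrite /Rintegral integral_pushforward//; exact/measurable_EFinP.
rewrite /Rintegral; congr fine.
by apply: eq_measure_integral => A mA _; case: BW => _ _ + _; apply.
Qed.

End brownian_increments.

Section partition_lemmas.
Context {R : realType}.
Implicit Types (a b : R) (t : nat -> R).

Lemma partition_le a b N t i j : Defs.partition a b N t -> (i <= j <= N)%N ->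
  t i <= t j.
Proof.
move=> [_ _ tS] /andP[+ jN].
elim: j jN => [|j IH] jN; first by rewrite leqn0 => /eqP ->.
rewrite leq_eqVlt => /predU1P[->//|]; rewrite ltnS => ij.
by rewrite (le_trans (IH (ltnW jN) ij))// ltW// tS.
Qed.

Lemma partition_itv a b N t j : Defs.partition a b N t -> (j <= N)%N -> a <= t j <= b.
Proof.
move=> p jN; have [ta tb _] := p.
rewrite -{1}ta -tb (partition_le (i := 0) (j := j) p) ?jN//.
by rewrite (partition_le p) ?jN ?leqnn.
Qed.

End partition_lemmas.

(** Clamping two nodes to [[t, t']] does not lengthen the interval between them. Hence the energy
    spent between [t] and [t'] is at most the total energy. *)
Lemma clamp_lip (R : realType) (t t' x y : R) : t <= t' -> x <= y ->
  Num.max t (Num.min y t') - Num.max t (Num.min x t') <= y - x.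
Proof.
move=> tt' xy; case: (leP x t') => x1; case: (leP y t') => y1;
  case: (leP t x) => x2; case: (leP t y) => y2; rewrite ?(max_r tt'); lra.
Qed.

(** * Isometry bound and martingale property of step integrals *)

Section brownian_sums.
Context {R : realType} {T : R} (P0 : probability (Omega T) R).
Variable W : R -> Omega T -> R.
Hypothesis BW : brownian_motion P0 W.
Local Notation L1 f := (P0.-integrable setT (EFin \o f)).
Local Notation past := (past_measurable P0 W).
Local Notation c := (4 * Num.sqrt 2 : R).

Lemma past_indep s t (Z : Omega T -> R) : 0 <= s -> s < t -> t <= T ->
  past s Z -> forall D E : set R, measurable D -> measurable E ->
  P0 (Z @^-1` D `&` (W t \- W s)%R @^-1` E) =
  (P0 (Z @^-1` D) * P0 ((W t \- W s)%R @^-1` E))%E.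
Proof.
move=> s0 st tT /past_measurableP mZ D E mD mE.
by apply: (filtration_independent BW) => //; exact: mZ.
Qed.

Lemma brownian_increment_measurable s t : 0 <= s -> s <= t -> t <= T ->
  measurable_fun setT (W t \- W s).
Proof.
move=> s0 st tT; apply: measurable_funB; apply: (brownian_measurable BW).
  by rewrite tT (le_trans s0 st).
by rewrite s0 (le_trans st tT).
Qed.

Lemma brownian_step_mean s t (Z : Omega T -> R) : 0 <= s -> s <= t -> t <= T ->
  past s Z -> L1 Z ->
  L1 (fun w => Z w * (W t w - W s w)) /\
  \int[P0]_w (Z w * (W t w - W s w)) = 0.
Proof.
move=> s0; rewrite le_eqVlt => /predU1P[->|st] tT mZ iZ.
  under [X in EFin \o X]eq_fun do rewrite subrr mulr0.
  under eq_Rintegral do rewrite subrr mulr0.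
  by split; [exact: integrable_cst|rewrite Rintegral_cst// mul0r].
have mZ' := past_measurableW BW (le_trans (ltW st) tT) mZ.
have mI := brownian_increment_measurable s0 (ltW st) tT.
have ind := past_indep s0 st tT mZ.
have [iI _ EI _] := brownian_increment_moments BW s0 st tT.
split; first exact: (indep_integrable mZ' mI ind).
by rewrite (indep_Rintegral_mul mZ' mI ind)// EI mulr0.
Qed.

Lemma brownian_step_sqr s t (Z : Omega T -> R) : 0 <= s -> s <= t -> t <= T ->
  past s Z -> L1 (fun w => Z w ^+ 2) ->
  L1 (fun w => (Z w * (W t w - W s w)) ^+ 2) /\
  \int[P0]_w (Z w * (W t w - W s w)) ^+ 2 <=
    c * ((\int[P0]_w Z w ^+ 2) * (t - s)).
Proof.
move=> s0; rewrite le_eqVlt => /predU1P[->|st] tT mZ iZ.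
  under [X in EFin \o X]eq_fun do rewrite subrr mulr0 expr0n.
  under eq_Rintegral do rewrite subrr mulr0 expr0n.
  split; [exact: integrable_cst|rewrite Rintegral_cst// mul0r].
  by rewrite subrr !mulr0.
have mZ' := past_measurableW BW (le_trans (ltW st) tT) mZ.
have mI := brownian_increment_measurable s0 (ltW st) tT.
have ind := past_indep s0 st tT mZ.
have [_ iI _ EI] := brownian_increment_moments BW s0 st tT.
apply: ge0_integrable_le.
- by apply: measurable_funX; apply: measurable_funM.
- by move=> w; exact: sqr_ge0.
under eq_integral do rewrite exprMn.
rewrite (indep_ge0_integral mZ' mI ind (f := fun x => x ^+ 2) (h := fun x => x ^+ 2));
  [|exact: exprn_measurable|exact: exprn_measurable|
    by move=> x; exact: sqr_ge0|by move=> x; exact: sqr_ge0].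
rewrite (Rintegral_EFin iZ) (Rintegral_EFin iI) -EFinM lee_fin.
rewrite mulrCA; apply: ler_wpM2l => //.
by apply: Rintegral_ge0 => w _; exact: sqr_ge0.
Qed.

(** Ito's isometry as an inequality. In the square of the last partial sum the cross term is a past
    factor, integrable as a product of two square-integrable variables, times a fresh increment; its
    mean is 0, so the second moments add up. The same argument with the past factor [phi * Z n]
    gives orthogonality to what is known at the initial node. *)
Lemma brownian_sum (n : nat) (a : nat -> R) (Z : nat -> Omega T -> R)
    (M : nat -> R) :
  (forall j, (j <= n)%N -> 0 <= a j <= T) ->
  (forall j, (j < n)%N -> a j <= a j.+1) ->
  (forall j, (j < n)%N -> past (a j) (Z j)) ->
  (forall j, (j < n)%N -> forall w, `|Z j w| <= M j) ->
  let Y := fun w => \sum_(j < n) Z j w * (W (a j.+1) w - W (a j) w) in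
  [/\ past (a n) Y, L1 (fun w => Y w ^+ 2),
      \int[P0]_w Y w ^+ 2 <=
        c * \sum_(j < n) ((\int[P0]_w Z j w ^+ 2) * (a j.+1 - a j)) &
      forall phi K, past (a 0%N) phi -> (forall w, `|phi w| <= K) ->
        \int[P0]_w (phi w * Y w) = 0].
Proof.
elim: n => [|n IH] aT aS mZ bZ Y.
  have Y0 : Y = fun=> 0 by apply/funext => w; rewrite /Y big_ord0.
  rewrite Y0 big_ord0 mulr0; split.
  - exact: measurable_cst.
  - by under [X in EFin \o X]eq_fun do rewrite expr0n; exact: integrable_cst.
  - by under eq_Rintegral do rewrite expr0n; rewrite Rintegral_cst// mul0r.
  - move=> phi K _ _; under eq_Rintegral do rewrite mulr0.
    by rewrite Rintegral_cst// mul0r.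
have [] := IH _ _ _ _.
- by move=> j jn; apply: aT; exact: leqW.
- by move=> j jn; apply: aS; exact: ltnW.
- by move=> j jn; apply: mZ; exact: ltnW.
- by move=> j jn; apply: bZ; exact: ltnW.
set Y' := (X in past _ X) => mY' iY' EY' mart.
have an0 : 0 <= a n by case/andP: (aT n (leqnSn n)).
have aST : a n.+1 <= T by case/andP: (aT n.+1 (leqnn _)).
have anS := aS n (leqnn _).
have anT := le_trans anS aST.
have mZn := mZ n (leqnn _).
have bZn := bZ n (leqnn _).
have mZn' := past_measurableW BW anT mZn.
have mY'' := past_measurableW BW anT mY'.
have iZn : L1 (Z n) by exact: (integrable_bounded P0 mZn' bZn).
have iZn2 : L1 (fun w => Z n w ^+ 2).
  apply: (integrable_bounded P0 (K := M n ^+ 2)); first exact: measurable_funX.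
  by move=> w; rewrite normrX lerXn2r// nnegrE// (le_trans _ (bZn w)).
pose D w := Z n w * (W (a n.+1) w - W (a n) w).
have YE : Y = fun w => Y' w + D w.
  by apply/funext => w; rewrite /Y big_ord_recr.
have [iD2 ED2] := brownian_step_sqr an0 anS aST mZn iZn2.
have mD : past (a n.+1) D.
  apply: measurable_funM; first exact: past_measurable_mono mZn.
  apply: measurable_funB; apply: past_measurable_brownian.
    by rewrite lexx (le_trans an0 anS).
  by rewrite an0 anS.
have mY : past (a n.+1) Y.
  by rewrite YE; apply: measurable_funD => //; exact: past_measurable_mono mY'.
have mDW := past_measurableW BW aST mD.
have mYW := past_measurableW BW aST mY.
have mYZ : past (a n) (fun w => Y' w * Z n w) by exact: measurable_funM.
have iYZ : L1 (fun w => Y' w * Z n w) by exact: integrable_mul_sqr.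
have [iYD EYD] := brownian_step_mean an0 anS aST mYZ iYZ.
have i2 : L1 (fun w => 2 * (Y' w * Z n w * (W (a n.+1) w - W (a n) w))).
  exact: integrable_scale.
have YE2 w : Y w ^+ 2 =
    Y' w ^+ 2 + 2 * (Y' w * Z n w * (W (a n.+1) w - W (a n) w)) + D w ^+ 2.
  by rewrite YE /D; ring.
split => //.
- under [X in EFin \o X]eq_fun do rewrite YE2.
  by apply: integrable_add => //; exact: integrable_add.
- under eq_Rintegral do rewrite YE2.
  rewrite !RintegralD//; [|exact: integrable_add].
  rewrite RintegralZl// EYD mulr0 addr0 big_ord_recr/= mulrDr.
  exact: lerD.
- move=> phi K mphi bphi.
  have aa : a 0%N <= a n.
    have : forall j, (j <= n)%N -> a 0%N <= a j.
      elim=> [//|j IHj] jn; apply: (le_trans (IHj (ltnW jn))).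
      by apply: aS; exact: ltnW.
    by apply.
  have mphin : past (a n) phi by exact: past_measurable_mono mphi.
  have mphiW := past_measurableW BW anT mphin.
  have mpZ : past (a n) (fun w => phi w * Z n w) by exact: measurable_funM.
  have ipZ : L1 (fun w => phi w * Z n w).
    exact: (integrable_mul_bounded mphiW bphi).
  have [ipD EpD] := brownian_step_mean an0 anS aST mpZ ipZ.
  have iY1 : L1 Y' by exact: integrable_sqr.
  transitivity (\int[P0]_w (phi w * Y' w +
      phi w * Z n w * (W (a n.+1) w - W (a n) w))).
    by apply: eq_Rintegral => w _; rewrite YE /D; ring.
  rewrite RintegralD//; last exact: (integrable_mul_bounded mphiW bphi).
  by rewrite EpD addr0 (mart phi K).
Qed.

(** The expectation of the time integral over [0, T] of the squared step process, for [h]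
    adapted. *)
Definition energy (h : step T) : R := \sum_(j < step_size h)
  (\int[P0]_w step_coef h j w ^+ 2) * (step_node h j.+1 - step_node h j).

(** Clamping all nodes to [[t, t']] turns the increment into a sum of the kind treated by
    [brownian_sum], starting no earlier than [t] and ending no later than [t']. *)
Lemma step_integral_increment (h : step T) (t t' : R) :
  adapted_step P0 W h -> 0 <= t -> t <= t' -> t' <= T ->
  let D := fun w => step_integral h W t' w - step_integral h W t w in
  [/\ past t' D, L1 (fun w => D w ^+ 2),
      \int[P0]_w D w ^+ 2 <= c * energy h &
      forall phi K, past t phi -> (forall w, `|phi w| <= K) ->
        \int[P0]_w (phi w * D w) = 0].
Proof.
move=> [ph ah] t0 tt' t'T D.
pose cl x := Num.max t (Num.min x t').
pose a j := cl (step_node h j).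
(* On a collapsed interval the coefficient is set to 0: if its node lies beyond [t'], the original
   coefficient need not be known at the clamped node. *)
pose Z j := if a j < a j.+1 then step_coef h j else fun=> 0.
set N := step_size h in ph ah *.
have cl_itv x : t <= cl x <= t'.
  by rewrite /cl le_max lexx/= ge_max tt' ge_min lexx orbT.
have clh x y : x <= y -> cl x <= cl y.
  by move=> xy; rewrite /cl; case: (leP x t'); case: (leP y t');
    case: (leP t x); case: (leP t y); rewrite ?(max_r tt'); lra.
have clD x (w : Omega T) : W (Num.min x t') w - W (Num.min x t) w = W (cl x) w - W t w.
  rewrite /cl; have [xt|xt] := leP x t.
    by rewrite (min_l (le_trans xt tt')) (max_l xt) !subrr.
  by rewrite max_r// le_min (ltW xt) tt'.
have DE w : D w = \sum_(j < N) Z j w * (W (a j.+1) w - W (a j) w).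
  rewrite /D /step_integral -sumrB; apply: eq_bigr => j _.
  rewrite -mulrBr.
  have -> : W (Num.min (step_node h j.+1) t') w - W (Num.min (step_node h j) t') w -
    (W (Num.min (step_node h j.+1) t) w - W (Num.min (step_node h j) t) w) =
    W (a j.+1) w - W (a j) w.
    have := clD (step_node h j.+1) w; have := clD (step_node h j) w.
    rewrite -/(a j) -/(a j.+1) => e1 e2.
    have sw (x y z u : R) : x - y - (z - u) = (x - z) - (y - u) by ring.
    by rewrite sw e1 e2; ring.
  rewrite /Z; case: ifPn => // aj.
  have -> : a j.+1 = a j.
    apply/eqP; rewrite eq_le leNgt aj/=; apply: clh.
    by case: ph => _ _ hS; apply/ltW/hS.
  by rewrite subrr !mulr0.
have -> : D = fun w => \sum_(j < N) Z j w * (W (a j.+1) w - W (a j) w).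
  by apply/funext => w.
have bex j : exists M : R, (j < N)%N -> forall w, `|Z j w| <= M.
  have [jN|jN] := ltnP j N; last by exists 0.
  have [_ [M hM]] := ah j jN; exists `|M| => _ w; rewrite /Z.
  by case: ifPn => _; rewrite ?normr0// (le_trans (hM w))// ler_norm.
have [M hM] := choice bex.
have aT j : 0 <= a j <= T.
  by have /andP[h1 h2] := cl_itv (step_node h j); rewrite (le_trans t0 h1) (le_trans h2 t'T).
have aS j : (j < N)%N -> a j <= a j.+1.
  by move=> jN; apply: clh; case: ph => _ _ hS; apply/ltW/hS.
have mZ j : (j < N)%N -> past (a j) (Z j).
  move=> jN; rewrite /Z; case: ifPn => aj; last exact: measurable_cst.
  have [mj _] := ah j jN.
  apply: (past_measurable_mono (s := step_node h j)); last exact/past_measurableP.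
  have tj : step_node h j <= t'.
    rewrite leNgt; apply/negP => tj.
    have tjS : t' < step_node h j.+1.
      by apply: (lt_trans tj); case: ph => _ _ hS; exact: hS.
    by move: aj; rewrite /a /cl (min_r (ltW tj)) (min_r (ltW tjS)) ltxx.
  by rewrite /a /cl (min_l tj) le_max lexx orbT.
have [h1 h2 h3 h4] := brownian_sum (n := N) (fun j _ => aT j) aS mZ hM.
split => //.
- have /andP[_ aN] := cl_itv (step_node h N); exact: past_measurable_mono h1.
- apply: (le_trans h3); rewrite ler_wpM2l//.
  apply: ler_sum => j _.
  have i0 : 0 <= \int[P0]_w step_coef h j w ^+ 2.
    by apply: Rintegral_ge0 => w _; exact: sqr_ge0.
  have tS : step_node h j <= step_node h j.+1.
    by case: ph => _ _ hS; apply/ltW/hS.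
  rewrite /Z; case: ifPn => aj; last first.
    under eq_Rintegral do rewrite expr0n.
    by rewrite Rintegral_cst// !mul0r mulr_ge0// subr_ge0.
  by rewrite ler_wpM2l// clamp_lip.
- move=> phi K mphi; apply: h4.
  by have /andP[aN _] := cl_itv (step_node h 0); exact: past_measurable_mono mphi.
Qed.

Lemma step_integral0 (h : step T) : adapted_step P0 W h ->
  step_integral h W 0 = fun=> 0.
Proof.
move=> [ph _]; apply/funext => w; rewrite /step_integral big1// => j _.
have /andP[h1 _] := partition_itv ph (ltnW (ltn_ord j)).
have /andP[h2 _] := partition_itv ph (ltn_ord j).
by rewrite !min_r// subrr mulr0.
Qed.

Lemma step_integral_past (h : step T) (t : R) : adapted_step P0 W h ->
  0 <= t <= T -> past t (step_integral h W t).
Proof.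
move=> ah /andP[t0 tT].
have [+ _ _ _] := step_integral_increment ah (lexx 0) t0 tT.
rewrite (step_integral0 ah).
by under eq_fun do rewrite subr0.
Qed.

End brownian_sums.

(** * Priors *)

Section weak_closure.
Context {R : realType} {T : R}.

Lemma coordinate_continuous (u : R) : 0 <= u <= T ->
  continuous (fun w : Omega T => sval w u).
Proof.
move=> uT w.
have FF : Filter (nbhs w) by exact: (@nbhs_filter (Omega T) w).
apply/cvgrPdist_lt => e e0.
have pc : continuous (@path_fun R T : Omega T -> {uniform` `[0, T] -> R}).
  exact: initial_continuous.
apply: (pc w [set h : {uniform` `[0, T] -> R} | `|sval w u - h u| < e]).
apply/uniform_nbhs; exists [set xy | `|xy.1 - xy.2| < e]; split.
  by rewrite -entourage_from_ballE; exists e.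
by move=> h /(_ u); apply; rewrite /= in_itv.
Qed.

Lemma lip_on_continuous (s : seq R) (psi : (R -> R) -> R) :
  (forall u, u \in s -> 0 <= u <= T) -> lip_on s psi ->
  continuous (fun w : Omega T => psi (sval w)).
Proof.
move=> sT [K [K0 _ Kl]] w.
have FF : Filter (nbhs w) by exact: (@nbhs_filter (Omega T) w).
have h : (fun w' : Omega T => K * dist_on s (sval w') (sval w)) w' @[w' --> w] --> (0 : R).
  have -> : (0 : R) = K * \sum_(u <- s) `|sval w u - sval w u|.
    by rewrite big1 ?mulr0// => u _; rewrite subrr normr0.
  apply: cvgM; first exact: cvg_cst.
  rewrite /dist_on.
  elim: s sT {Kl} => [|u s IH] sT.
    under eq_fun do rewrite big_nil.
    by rewrite big_nil; exact: cvg_cst.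
  under eq_fun do rewrite big_cons.
  rewrite big_cons; apply: cvgD; last first.
    by apply: IH => v vs; apply: sT; rewrite inE vs orbT.
  apply: cvg_norm; apply: cvgB; last exact: cvg_cst.
  by apply: coordinate_continuous; apply: sT; rewrite mem_head.
apply/cvgrPdist_le => e e0.
move/cvgrPdist_le : h => /(_ e e0); apply: filterS => w' /=.
rewrite sub0r normrN => h; rewrite distrC (le_trans (Kl _ _))//.
by rewrite (le_trans (ler_norm _)).
Qed.

(** In the initial topology, integration against a bounded continuous function is continuous, so an
    upper bound on the integral defines a closed set of measures. *)
Lemma closure_integral_le (V : set (probability (Omega T) R)) (f : Omega T -> R)
    (M c : R) (P : probability (Omega T) R) :
  continuous f -> (forall w, `|f w| <= M) ->
  (forall P', V P' -> \int[P']_w f w <= c) ->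
  closure (V : set (initial_topology (@bc_integral R T))) P ->
  \int[P]_w f w <= c.
Proof.
move=> cf bf hV hP.
pose F : bounded_continuous := exist _ f (conj cf (ex_intro _ M bf)).
have cont : continuous (fun P : initial_topology (@bc_integral R T) =>
    @bc_integral R T P F).
  move=> Q; apply: (@continuous_comp _ _ _
    (@bc_integral R T : initial_topology (@bc_integral R T) -> {ptws (@bounded_continuous R T) -> R})
    (fun g => g F)).
    exact: initial_continuous.
  set g := bc_integral _ => A nA.
  have /cvg_sup/(_ F) h : nbhs g --> g by exact: cvg_id.
  by apply: h; exact: (@initial_continuous _ _ (fun f : bounded_continuous -> R => f F) g A nA).
pose C := (fun P : initial_topology (@bc_integral R T) =>
    @bc_integral R T P F) @^-1` [set x | x <= c].
have cC : closed C.
  by move/continuous_closedP : cont; apply; exact: closed_le.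
have : closure C P by apply: closureS hP => P'; exact: hV.
by rewrite -((closure_id C).1 cC).
Qed.

End weak_closure.

(** * Energy of the step processes approximating a volatility *)

Section step_energy.
Context {R : realType} {T : R}.
Local Notation mu := (@lebesgue_measure R).
Implicit Types (h : step T) (w : Omega T).

Lemma step_indicatorE h j s :
  ((step_node h j <= s < step_node h j.+1)%R%:R : R) =
  \1_(`[step_node h j, step_node h j.+1[%classic) s.
Proof. by rewrite indicE mem_setE in_itv. Qed.

Lemma step_process_sqr h s w :
  Defs.partition 0 T (step_size h) (step_node h) ->
  step_process h s w ^+ 2 = \sum_(j < step_size h)
    step_coef h j w ^+ 2 * (step_node h j <= s < step_node h j.+1)%R%:R.
Proof.
move=> ph; rewrite /step_process.
have disj (i j : 'I_(step_size h)) : step_node h i <= s < step_node h i.+1 ->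
    step_node h j <= s < step_node h j.+1 -> i = j.
  move=> /andP[i1 i2] /andP[j1 j2]; apply/val_inj/eqP; rewrite eqn_leq.
  apply/andP; split; rewrite leqNgt; apply/negP => ij.
    have : step_node h j.+1 <= step_node h i.
      by apply: (partition_le ph); rewrite ij/= ltnW.
    lra.
  have : step_node h i.+1 <= step_node h j.
    by apply: (partition_le ph); rewrite ij/= ltnW.
  lra.
case: (pickP (fun j : 'I_(step_size h) => step_node h j <= s < step_node h j.+1)).
  move=> k hk.
  rewrite (bigD1 k)//= [in RHS](bigD1 k)//= hk !mulr1.
  rewrite !big1 ?addr0// => j jk; case: (boolP (_ <= s < _)) => hj; rewrite ?mulr0//;
    by move: jk; rewrite (disj _ _ hk hj) eqxx.
by move=> h0; rewrite !big1 ?expr0n// => j _; rewrite h0 mulr0.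
Qed.

Lemma integral_step_process_sqr h w :
  Defs.partition 0 T (step_size h) (step_node h) ->
  (\int[mu]_(s in `[0%R, T]) (step_process h s w ^+ 2)%:E =
   (\sum_(j < step_size h) step_coef h j w ^+ 2 *
      (step_node h j.+1 - step_node h j))%:E)%E.
Proof.
move=> ph.
under eq_integral do rewrite step_process_sqr// -sumEFin.
rewrite ge0_integral_sum//; last 2 first.
- move=> j; apply/measurable_EFinP; apply: measurable_funM => //.
  rewrite [X in measurable_fun _ X](_ : _ =
    \1_(`[step_node h j, step_node h j.+1[%classic)); last first.
    by apply/funext => s; exact: step_indicatorE.
  exact: measurable_indic.
- by move=> j s _; rewrite lee_fin mulr_ge0// sqr_ge0.
rewrite -sumEFin; apply: eq_bigr => j _.
under eq_integral do rewrite EFinM step_indicatorE.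
rewrite ge0_integralZl//; last first.
- by rewrite lee_fin sqr_ge0.
- by apply/measurable_EFinP; exact: measurable_indic.
rewrite integral_indic// [RHS]EFinM; congr (_ * _)%E.
have /andP[h1 _] := partition_itv ph (ltnW (ltn_ord j)).
have /andP[_ h2] := partition_itv ph (ltn_ord j).
have hS : step_node h j < step_node h j.+1 by case: ph => _ _; apply.
rewrite setIidl; last first.
  move=> s /=; rewrite !in_itv/= => /andP[s1 s2].
  by rewrite (le_trans h1 s1) (le_trans (ltW s2) h2).
by apply: (etrans (lebesgue_measure_itv `[step_node h j, step_node h j.+1[));
  rewrite /= lte_fin hS EFinB.
Qed.

Variables (P0 : probability (Omega T) R) (W : R -> Omega T -> R).
Hypothesis BW : brownian_motion P0 W.
Variables (theta : R -> Omega T -> R) (su : R).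
Hypothesis T0 : 0 < T.
Hypothesis mtheta : jointly_measurable theta.
Hypothesis theta_le : forall t w, t \in `[0, T] -> `|theta t w| <= su.

Lemma step_coef_measurable h j : adapted_step P0 W h -> (j < step_size h)%N ->
  measurable_fun setT (step_coef h j).
Proof.
move=> [ph ah] jN _ A mA; rewrite setTI.
have /andP[_ jT] := partition_itv ph (ltnW jN).
by have [/(_ A mA) h1 _] := ah j jN; exact: (filtration_measurable BW jT h1).
Qed.

Lemma step_process_measurable h : adapted_step P0 W h ->
  measurable_fun setT (fun p : R * Omega T => step_process h p.1 p.2).
Proof.
move=> ah; rewrite /step_process; apply: measurable_sum => j.
apply: measurable_funM.
  by apply: measurableT_comp => //; exact: step_coef_measurable.
under eq_fun do rewrite step_indicatorE.
by apply: measurableT_comp => //; exact: measurable_indic.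
Qed.

(** Pointwise y^2 <= 2 (x - y)^2 + 2 x^2, with x the volatility, bounded by [su], and y the step
    process; integrating over time and paths gives the claim. *)
Lemma energy_le h : adapted_step P0 W h ->
  ((energy P0 h)%:E <= 2%:E * \int[P0]_w \int[mu]_(s in `[0%R, T])
     ((theta s w - step_process h s w) ^+ 2)%:E + (2 * su ^+ 2 * T)%:E)%E.
Proof.
move=> ah; have [ph cah] := ah.
pose D : set (R * Omega T) := `[0, T]%classic `*` setT.
have mD : measurable D by exact: measurableX.
(* Extending the integrand by 0 outside [0, T] gives a function measurable on the whole product
   space, as Tonelli's theorem asks. *)
pose G := (fun p : R * Omega T =>
  (((theta p.1 p.2 - step_process h p.1 p.2) ^+ 2)%:E : \bar R)) \_ D.
have mG : measurable_fun setT G.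
  apply/(measurable_restrictT _ mD); apply/measurable_EFinP.
  apply: measurable_funX; apply: measurable_funB; first exact: mtheta.
  by apply: measurable_funTS; exact: step_process_measurable.
have G0 p : (0 <= G p)%E.
  by rewrite /G patchE; case: ifPn => // _; rewrite lee_fin sqr_ge0.
have GE w : (\int[mu]_(s in `[0%R, T]) ((theta s w - step_process h s w) ^+ 2)%:E =
    \int[mu]_s G (s, w))%E.
  rewrite integral_mkcond; apply: eq_integral => s _.
  rewrite /G !patchE; congr (if _ then _ else _).
  by apply/idP/idP; rewrite !inE /D/=; [move=> ?; split|case].
have mI : measurable_fun setT (fun w => \int[mu]_s G (s, w))%E.
  exact: (measurable_fun_fubini_tonelli_G (m1 := mu) G).
have I0 w : (0 <= \int[mu]_s G (s, w))%E by apply: integral_ge0 => s _; exact: G0.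
under eq_integral do rewrite GE.
have coefi j : (j < step_size h)%N ->
    P0.-integrable setT (EFin \o (fun w => step_coef h j w ^+ 2)).
  move=> jN; have [_ [M hM]] := cah j jN.
  apply: (integrable_bounded P0 (K := M ^+ 2)).
    by apply: measurable_funX; exact: step_coef_measurable.
  by move=> w; rewrite normrX lerXn2r// nnegrE// (le_trans _ (hM w)).
have -> : (energy P0 h)%:E = (\int[P0]_w (\sum_(j < step_size h) step_coef h j w ^+ 2 *
      (step_node h j.+1 - step_node h j))%:E)%E.
  rewrite /energy -sumEFin.
  under [RHS]eq_integral do rewrite -sumEFin.
  rewrite ge0_integral_sum//; last 2 first.
  - move=> j; apply/measurable_EFinP; apply: measurable_funM => //.
    by apply: measurable_funX; exact: step_coef_measurable.
  - move=> j w _; rewrite lee_fin mulr_ge0 ?sqr_ge0// subr_ge0.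
    by case: ph => _ _ hS; apply/ltW/hS.
  apply: eq_bigr => j _; rewrite -RintegralZr//; last exact: coefi.
  rewrite -Rintegral_EFin//.
  under [X in P0.-integrable _ (EFin \o X)]eq_fun do rewrite mulrC.
  by apply: integrable_scale; exact: coefi.
have muT : (mu `[0%R, T]%classic = T%:E)%E.
  by apply: (etrans (lebesgue_measure_itv `[0, T])); rewrite /= lte_fin T0 sube0.
have c0 : 0 <= 2 * su ^+ 2 by rewrite mulr_ge0 ?sqr_ge0.
apply: (@le_trans _ _ (\int[P0]_w (2%:E * \int[mu]_s G (s, w) + (2 * su ^+ 2 * T)%:E))%E).
  apply: ge0_le_integral => //.
  - move=> w _; rewrite lee_fin; apply: sumr_ge0 => j _.
    by rewrite mulr_ge0 ?sqr_ge0// subr_ge0; case: ph => _ _ hS; apply/ltW/hS.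
  - apply/measurable_EFinP; apply: measurable_sum => j; apply: measurable_funM => //.
    by apply: measurable_funX; exact: step_coef_measurable.
  - by apply: emeasurable_funD => //; exact: measurable_funeM.
  move=> w _; rewrite -integral_step_process_sqr// integral_mkcond.
  have mGw : measurable_fun setT (fun s => G (s, w)).
    exact: measurableT_comp.
  have -> : (2 * su ^+ 2 * T)%:E =
      (\int[mu]_s ((2 * su ^+ 2)%:E * (\1_(`[0, T]%classic) s)%:E))%E.
    rewrite ge0_integralZl//; last by apply/measurable_EFinP; exact: measurable_indic.
    by rewrite integral_indic// setIT [LHS]EFinM; congr (_ * _)%E; apply/esym; exact: muT.
  rewrite -ge0_integralZl// -ge0_integralD//; last 4 first.
  - by move=> s _; rewrite mule_ge0.
  - exact: measurable_funeM.
  - by move=> s _; rewrite mule_ge0 ?lee_fin.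
  - by apply/measurable_funeM/measurable_EFinP; exact: measurable_indic.
  apply: ge0_le_integral => //.
  - by move=> s _; rewrite patchE; case: ifPn => // _; rewrite lee_fin sqr_ge0.
  - apply/(measurable_restrictT _ (measurable_itv `[0, T])).
    apply/measurable_EFinP/measurable_funX/measurable_funTS.
    apply: (measurableT_comp (g := fun s : R => (s, w))
      (f := fun p : R * Omega T => step_process h p.1 p.2)) => //.
    exact: step_process_measurable.
  - apply: emeasurable_funD; first exact: measurable_funeM.
    by apply/measurable_funeM/measurable_EFinP; exact: measurable_indic.
  move=> s _; rewrite /G !patchE indicE.
  have -> : ((s, w) \in D) = (s \in `[0, T]%classic).
    by apply/idP/idP; rewrite !inE /D/=; [case|move=> ?; split].
  case: ifPn => sT; last by rewrite !mule0 adde0.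
  rewrite mule1 -EFinM -EFinD lee_fin.
  have := theta_le w (t := s); rewrite inE in sT => /(_ sT).
  rewrite ler_norml => /andP[h1 h2].
  set x := theta s w in h1 h2 *; set y := step_process h s w.
  have : x ^+ 2 <= su ^+ 2 by nra.
  (* The difference 2 (x - y)^2 + 2 x^2 - y^2 is exactly (2 x - y)^2. *)
  have := sqr_ge0 (2 * x - y); nra.
rewrite ge0_integralD//; last 3 first.
- by move=> w _; rewrite mule_ge0.
- exact: measurable_funeM.
- by move=> w _; rewrite lee_fin mulr_ge0// ltW.
rewrite ge0_integralZl//; apply: leeD => //.
by rewrite (Rintegral_EFin (integrable_cst P0 _)) Rintegral_const.
Qed.

End step_energy.

Lemma cvg0_le (R : realType) (u : nat -> \bar R) (e : R) :
  u n @[n --> \oo] --> 0%E -> 0 < e -> \forall n \near \oo, (u n <= e%:E)%E.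
Proof.
move=> /fine_cvgP[fu cu] e0; move/cvgrPdist_le : cu => /(_ e e0) cu.
apply: filterS2 fu cu => n fn; rewrite sub0r normrN => un.
by rewrite -(fineK fn) lee_fin (le_trans (ler_norm _)).
Qed.

(** Integrate |f| <= e / 2 + f^2 / (2 e) once the second moment has dropped to at most e^2. *)
Lemma cvg_L2_L1 d (X : measurableType d) (R : realType) (P : probability X R)
    (f_ : nat -> X -> R) (e : R) :
  (forall n, measurable_fun setT (f_ n)) ->
  (\int[P]_x (f_ n x ^+ 2)%:E)%E @[n --> \oo] --> 0%E -> 0 < e ->
  \forall n \near \oo, P.-integrable setT (EFin \o f_ n) /\
    \int[P]_x `|f_ n x| <= e.
Proof.
move=> mf cf e0.
have e20 : 0 < e ^+ 2 by rewrite exprn_gt0.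
apply: filterS (cvg0_le cf e20) => n hn.
have [i2 b2] := ge0_integrable_le (measurable_funX 2 (mf n))
  (fun x => sqr_ge0 (f_ n x)) hn.
have i1 := integrable_sqr (mf n) i2.
split => //.
have i3 : P.-integrable setT (EFin \o (fun x => 2^-1 * e + (2 * e)^-1 * f_ n x ^+ 2)).
  by apply: integrable_add; [exact: integrable_cst|exact: integrable_scale].
apply: (@le_trans _ _ (\int[P]_x (2^-1 * e + (2 * e)^-1 * f_ n x ^+ 2))).
  apply: le_Rintegral => //; first exact: integrable_abs.
  move=> x _; rewrite -real_normK ?num_real//.
  have := sqr_ge0 (e - `|f_ n x|); set y := `|f_ n x| => h.
  rewrite -(ler_pM2l (x := 2 * e)) ?mulr_gt0// mulrDr mulVKf ?gt_eqF ?mulr_gt0//.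
  have -> : 2 * e * (2^-1 * e) = e ^+ 2 by field.
  nra.
rewrite RintegralD//; [|exact: integrable_cst|exact: integrable_scale].
rewrite Rintegral_const RintegralZl//.
have : (2 * e)^-1 * (\int[P]_x f_ n x ^+ 2) <= (2 * e)^-1 * e ^+ 2.
  by rewrite ler_wpM2l// invr_ge0 mulr_ge0// ltW.
have -> : (2 * e)^-1 * e ^+ 2 = 2^-1 * e by field; rewrite gt_eqF.
by move=> h; rewrite (le_trans (lerD (lexx _) h))//; lra.
Qed.

(** * From step integrals to laws of stochastic integrals and their weak limits *)

Section prior_bounds.
Context {R : realType} {T : R} (P0 : probability (Omega T) R).
Variables (W : R -> Omega T -> R) (sl su : R).
Hypotheses (BW : brownian_motion P0 W) (T0 : 0 < T) (sl0 : 0 < sl).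
Implicit Types (psi : (R -> R) -> R) (s : seq R).

(** The bound of [energy_le], where the 1 leaves room for twice an approximation error that is
    eventually at most 1/2. *)
Local Notation E0 := (2 * su ^+ 2 * T + 1).
Local Notation past := (past_measurable P0 W).

Lemma coordinate_measurable (u : R) : 0 <= u <= T ->
  measurable_fun setT (fun w : Omega T => sval w u).
Proof.
move=> uT; apply: (measurability _ (RGenOpens.measurableE R)).
move=> _ [_ [a [b ->]] <-]; rewrite setTI.
apply: sub_sigma_algebra.
have /continuousP := coordinate_continuous uT; apply.
exact: interval_open.
Qed.

Lemma step_integral_measurable h t : adapted_step P0 W h -> 0 <= t <= T ->
  measurable_fun setT (step_integral h W t).
Proof.
move=> ah tT; have /andP[_ tT'] := tT.
exact: (past_measurableW BW tT' (step_integral_past BW ah tT)).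
Qed.

(** The integral under [P] is that of [psi] along [M]. At the finitely many times of [s], step
    integrals of energy at most [E0] approximate [M] in L2, hence in L1, and the Lipschitz bound
    makes the resulting error in [psi] arbitrarily small. *)
Lemma volatility_law_bound (P : probability (Omega T) R) s psi (c : R) :
  (forall u, u \in s -> 0 <= u <= T) -> lip_on s psi ->
  (forall h, adapted_step P0 W h -> energy P0 h <= E0 ->
     \int[P0]_w psi (fun u => step_integral h W u w) <= c) ->
  volatility_laws P0 W sl su P -> \int[P]_w psi (sval w) <= c.
Proof.
move=> sT psiL hc [theta [M [jt _ bt [mM [h [ah cE cM]]] PM]]].
have [K [K0 Kb Kl]] := psiL.
have mpsi : measurable_fun setT (fun w : Omega T => psi (sval w)).
  apply: (measurable_lip_on (Y := fun u (w : Omega T) => sval w u) psiL).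
  by move=> u us; exact: coordinate_measurable (sT u us).
have mMu u : u \in s -> measurable_fun setT (fun w => sval (M w) u).
  move=> us; apply: (measurableT_comp (f := fun w : Omega T => sval w u)) => //.
  exact: coordinate_measurable (sT u us).
have mpsiM : measurable_fun setT (fun w => psi (sval (M w))).
  exact: (measurable_lip_on (Y := fun u w => sval (M w) u) psiL).
have -> : \int[P]_w psi (sval w) = \int[P0]_w psi (sval (M w)).
  pose mM' := isMeasurableFun.Build _ _ _ _ _ mM.
  pose M' : {mfun _ >-> _} := HB.pack M mM'.
  rewrite /Rintegral; congr fine.
  transitivity (\int[pushforward P0 M']_w (psi (sval w))%:E)%E.
    by apply: eq_measure_integral => A mA _; exact: PM.
  rewrite integral_pushforward//; first exact/measurable_EFinP.
  exact: (integrable_bounded P0 mpsiM (fun w => Kb _)).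
have iM : P0.-integrable setT (EFin \o (fun w => psi (sval (M w)))).
  exact: (integrable_bounded P0 mpsiM (fun w => Kb _)).
have bt' t w : t \in `[0, T] -> `|theta t w| <= su.
  by move=> tT; have /andP[h1 h2] := bt t w tT; rewrite ger0_norm// (le_trans (ltW sl0)).
have near_energy : \forall n \near \oo, energy P0 (h n) <= E0.
  have h2 : 0 < 2^-1 :> R by rewrite invr_gt0.
  apply: filterS (cvg0_le cE h2) => n hn.
  rewrite -lee_fin (le_trans (energy_le BW T0 jt bt' (ah n)))//.
  have hn1 := lee_wpmul2l (lee_tofin (ler0n R 2)) hn.
  apply: (le_trans (leeD hn1 (lexx _))).
  by rewrite -EFinM divff// -EFinD lee_fin addrC.
have near_dist (e : R) : 0 < e -> \forall n \near \oo,
    P0.-integrable setT (EFin \o (fun w => dist_on s (sval (M w))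
      (fun u => step_integral (h n) W u w))) /\
    \int[P0]_w dist_on s (sval (M w)) (fun u => step_integral (h n) W u w) <= e.
  elim: s sT {psiL Kl mpsi mMu mpsiM iM} e => [|u s IH] sT e e0.
    near=> n; rewrite /dist_on.
    under [X in EFin \o X]eq_fun do rewrite big_nil.
    under eq_Rintegral do rewrite big_nil.
    by rewrite Rintegral_const ltW//; split => //; exact: integrable_cst.
  have e20 : 0 < e / 2 by rewrite divr_gt0.
  have uT := sT u (mem_head _ _).
  have h1 : \forall n \near \oo,
      P0.-integrable setT (EFin \o (fun w => B u (M w) - step_integral (h n) W u w)) /\
      \int[P0]_w `|B u (M w) - step_integral (h n) W u w| <= e / 2.
    apply: cvg_L2_L1 => //; last by apply: cM; rewrite in_itv.
    move=> n; apply: measurable_funB; last exact: step_integral_measurable.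
    apply: (measurableT_comp (f := fun w : Omega T => sval w u)) => //.
    exact: coordinate_measurable.
  have h2 := IH (fun v vs => sT v (mem_behead (s := u :: s) vs)) _ e20.
  apply: filterS2 h1 h2 => n [i1 b1] [i2 b2]; rewrite /dist_on.
  under [X in EFin \o X]eq_fun do rewrite big_cons.
  under eq_Rintegral do rewrite big_cons.
  have i1' := integrable_abs i1.
  split; first exact: integrable_add.
  rewrite RintegralD//; rewrite (splitr e); exact: lerD.
apply/ler_addgt0Pl => e e0.
have K10 : 0 < e / (K + 1) by rewrite divr_gt0// ltr_wpDl.
have [n [en [idn dn]]] : exists n, energy P0 (h n) <= E0 /\
    P0.-integrable setT (EFin \o (fun w => dist_on s (sval (M w))
      (fun u => step_integral (h n) W u w))) /\
    \int[P0]_w dist_on s (sval (M w)) (fun u => step_integral (h n) W u w) <= e / (K + 1).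
  have : \forall n \near \oo, energy P0 (h n) <= E0 /\
    P0.-integrable setT (EFin \o (fun w => dist_on s (sval (M w))
      (fun u => step_integral (h n) W u w))) /\
    \int[P0]_w dist_on s (sval (M w)) (fun u => step_integral (h n) W u w) <= e / (K + 1).
    by apply: filterS2 near_energy (near_dist _ K10) => n.
  by move=> /filter_ex.
have mN : measurable_fun setT (fun w => psi (fun u => step_integral (h n) W u w)).
  apply: (measurable_lip_on psiL) => u us.
  exact: step_integral_measurable (ah n) (sT u us).
have iN : P0.-integrable setT (EFin \o (fun w => psi (fun u => step_integral (h n) W u w))).
  exact: (integrable_bounded P0 mN (fun w => Kb _)).
apply: (@le_trans _ _ (\int[P0]_w (K * dist_on s (sval (M w)) (fun u => step_integral (h n) W u w)
   + psi (fun u => step_integral (h n) W u w)))).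
  apply: le_Rintegral => //; first exact: integrable_add (integrable_scale K idn) iN.
  move=> w _; rewrite -lerBlDr.
  by rewrite (le_trans (ler_norm _)).
rewrite RintegralD//; last exact: integrable_scale.
rewrite RintegralZl//; apply: lerD; last exact: hc.
apply: (@le_trans _ _ (K * (e / (K + 1)))); first exact: ler_wpM2l.
by rewrite mulrA ler_pdivrMr ?ltr_wpDl// mulrC ler_wpM2l ?(ltW e0)// lerDl.
Unshelve. all: by end_near. Qed.

(** This reduces an estimate under an arbitrary prior, possibly a weak limit without a volatility
    process, to step integrals with respect to [W] of uniformly bounded energy. *)
Lemma prior_bound (P : probability (Omega T) R) s psi (c : R) :
  (forall u, u \in s -> 0 <= u <= T) -> lip_on s psi ->
  (forall h, adapted_step P0 W h -> energy P0 h <= E0 ->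
     \int[P0]_w psi (fun u => step_integral h W u w) <= c) ->
  priors P0 W sl su P -> \int[P]_w psi (sval w) <= c.
Proof.
move=> sT psiL hc PQ; have [K [_ Kb _]] := psiL.
apply: (closure_integral_le (M := K) _ _ _ PQ).
- exact: lip_on_continuous sT psiL.
- by move=> w; exact: Kb.
- by move=> P'; exact: (volatility_law_bound sT psiL hc).
Qed.

End prior_bounds.

(** * Clipped increments as bounded Lipschitz functionals *)

Section clipping.
Context {R : realType}.
Implicit Types (x y r : R).

Definition clip r x : R := Num.max (- r) (Num.min x r).

Lemma clip_bounded r x : 0 <= r -> `|clip r x| <= r.
Proof.
move=> r0; rewrite /clip ler_norml.
have rr : - r <= r by lra.
case: (leP x r) => c1; rewrite ?(max_r rr); last by apply/andP; split; lra.
by case: (leP (- r) x) => c2; apply/andP; split; lra.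
Qed.

Lemma clip_lip r x y : 0 <= r -> `|clip r x - clip r y| <= `|x - y|.
Proof.
move=> r0; rewrite /clip; have rr : - r <= r by lra.
have := ler_norm (x - y); have := ler_norm (y - x); rewrite (distrC y x).
set d := `|x - y| => h1 h2; have d0 : 0 <= d by exact: normr_ge0.
rewrite ler_norml; case: (leP x r) => c1; case: (leP y r) => c2; rewrite ?(max_r rr).
- by case: (leP (- r) x) => c3; case: (leP (- r) y) => c4; apply/andP; split; lra.
- by case: (leP (- r) x) => c3; apply/andP; split; lra.
- by case: (leP (- r) y) => c3; apply/andP; split; lra.
- by apply/andP; split; lra.
Qed.

Lemma clip_id r x : `|x| <= r -> clip r x = x.
Proof.
by rewrite ler_norml => /andP[h1 h2]; rewrite /clip (min_l h2) (max_r h1).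
Qed.

Lemma clip_abs r x : 0 <= r -> `|clip r x| <= `|x|.
Proof. by move=> r0; have := clip_lip x 0 r0; rewrite (clip_id (x := 0)) ?normr0// !subr0. Qed.

(** There is no error for |x| <= r; beyond, it is at most |x|, and |x| r <= x^2. *)
Lemma clip_error r x : 0 < r -> `|clip r x - x| <= x ^+ 2 / r.
Proof.
move=> r0; rewrite ler_pdivlMr//.
have [xr|xr] := leP `|x| r.
  by rewrite clip_id// subrr normr0 mul0r sqr_ge0.
have : `|clip r x - x| <= `|x|.
  rewrite /clip; have [x0|x0] := leP 0 x.
    rewrite (ger0_norm x0) in xr *; rewrite (min_r (ltW xr)) max_r; last lra.
    by rewrite ler_norml; apply/andP; split; lra.
  rewrite (ltr0_norm x0) in xr *; rewrite min_l; last lra.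
  rewrite max_l; last lra.
  by rewrite ler_norml; apply/andP; split; lra.
rewrite -real_normK ?num_real//.
by have := normr_ge0 x; have := normr_ge0 (clip r x - x); nra.
Qed.

Lemma norm_le_1Dsqr x : `|x| <= 1 + x ^+ 2.
Proof. by rewrite ler_norml; apply/andP; split; nra. Qed.

Lemma measurable_clip r : measurable_fun setT (clip r).
Proof.
apply: measurable_maxr => //; exact: measurable_minr.
Qed.

(** Stated for a general [h] to serve both the clipped increment and the truncated absolute value of
    the increment. *)
Lemma lip_on_increment t t' (h : R -> R) r : 0 <= r ->
  (forall x, `|h x| <= r) -> (forall x y, `|h x - h y| <= `|x - y|) ->
  lip_on [:: t; t'] (fun f => h (f t' - f t)).
Proof.
move=> r0 hr hl; exists (r + 1); split; first by rewrite addr_ge0.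
  by move=> f; rewrite (le_trans (hr _))// lerDl.
move=> f g; rewrite (le_trans (hl _ _))// /dist_on !big_cons big_nil addr0.
have -> : f t' - f t - (g t' - g t) = (f t' - g t') - (f t - g t) by ring.
rewrite (le_trans (ler_normB _ _))// addrC ler_peMl ?addr_ge0//.
by rewrite lerDr.
Qed.

Lemma lip_on_mul s s' (phi psi : (R -> R) -> R) : lip_on s phi -> lip_on s' psi ->
  lip_on (s ++ s') (fun f => phi f * psi f).
Proof.
move=> [K [K0 Kb Kl]] [L [L0 Lb Ll]]; exists (K * L).
split; first exact: mulr_ge0.
  by move=> f; rewrite normrM ler_pM.
move=> f g.
have -> : phi f * psi f - phi g * psi g =
  (phi f - phi g) * psi f + phi g * (psi f - psi g) by ring.
rewrite (le_trans (ler_normD _ _))// !normrM dist_on_cat mulrDr lerD//.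
  by rewrite mulrAC ler_pM.
by rewrite -mulrA ler_pM.
Qed.

End clipping.

(** * The martingale property under every prior *)

Section prior_martingale.
Context {R : realType} {T : R} (P0 : probability (Omega T) R).
Variables (W : R -> Omega T -> R) (sl su : R).
Hypotheses (BW : brownian_motion P0 W) (T0 : 0 < T) (sl0 : 0 < sl).
Variable P : probability (Omega T) R.
Hypothesis PQ : priors P0 W sl su P.
Local Notation L1 P f := (P.-integrable setT (EFin \o f)).
Local Notation E0 := (2 * su ^+ 2 * T + 1).
Local Notation C0 := (4 * Num.sqrt 2 * E0 : R).

(** Weak limits are only tested on bounded functions, so |x| is truncated at n. The truncation is at
    most 1 + x^2, which bounds its mean by [1 + C0] for every n, and Fatou's lemma removes the
    truncation under [P]. *)
Lemma prior_increment_integrable t t' : 0 <= t -> t <= t' -> t' <= T ->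
  L1 P (fun w => sval w t' - sval w t).
Proof.
move=> t0 tt' t'T.
have mD : measurable_fun setT (fun w : Omega T => sval w t' - sval w t).
  apply: measurable_funB; apply: coordinate_measurable.
    by rewrite (le_trans t0).
  by rewrite t0 (le_trans tt').
have abs_bd (n : nat) : \int[P]_w Num.min `|sval w t' - sval w t| n%:R <= 1 + C0.
  have hl : lip_on [:: t; t'] (fun f : R -> R => Num.min `|f t' - f t| n%:R).
    apply: (lip_on_increment t t' (h := fun x : R => Num.min `|x| n%:R) (r := n%:R)) => //.
      by move=> x; rewrite ger0_norm ?ge_min ?lexx ?orbT// le_min normr_ge0 ler0n.
    move=> x y; have := ler_dist_dist x y; rewrite !ler_norml => /andP[h1 h2].
    by case: (leP `|x| n%:R) => c1; case: (leP `|y| n%:R) => c2; apply/andP; split; lra.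
  apply: (prior_bound BW T0 sl0 _ hl _ PQ).
    move=> u; rewrite !inE => /orP[/eqP ->|/eqP ->].
      by rewrite t0 (le_trans tt').
    by rewrite (le_trans t0).
  move=> h ah eh.
  have [_ i2 b2 _] := step_integral_increment BW ah t0 tt' t'T.
  have i3 := integrable_add (integrable_cst P0 1) i2.
  apply: (@le_trans _ _ (\int[P0]_w (1 + (step_integral h W t' w - step_integral h W t w) ^+ 2))).
    apply: le_Rintegral => //.
      apply: (integrable_le _ i3).
        apply: measurable_minr => //; apply: measurableT_comp => //.
        by apply: measurable_funB; apply: (step_integral_measurable BW) => //;
          rewrite ?t0 ?(le_trans t0 tt') ?(le_trans tt' t'T).
      move=> w; rewrite ger0_norm; last by rewrite le_min normr_ge0 ler0n.
      rewrite ge_min; apply/orP; left; exact: norm_le_1Dsqr.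
    by move=> w _; rewrite ge_min; apply/orP; left; exact: norm_le_1Dsqr.
  rewrite RintegralD//; last exact: integrable_cst.
  rewrite Rintegral_const lerD2l (le_trans b2)// ler_wpM2l//.
have im (n : nat) : L1 P (fun w => Num.min `|sval w t' - sval w t| n%:R).
  apply: (integrable_bounded P (K := n%:R)).
    by apply: measurable_minr => //; exact: measurableT_comp.
  by move=> x; rewrite ger0_norm ?ge_min ?lexx ?orbT// le_min normr_ge0 ler0n.
have m0 (n : nat) (w : Omega T) : 0 <= Num.min `|sval w t' - sval w t| n%:R.
  by rewrite le_min normr_ge0 ler0n.
have me (w : Omega T) : \forall n \near \oo,
    Num.min `|sval w t' - sval w t| n%:R = `|sval w t' - sval w t|.
  by near=> n; apply: min_l; near: n; exact: nbhs_infty_ger.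
have [ia _] := fatou_bound im m0 me abs_bd.
exact: (integrable_le mD ia).
Unshelve. all: by end_near. Qed.

(** Under a step integral, [phi] times the increment D clipped at level r is at most phi D + (K / r)
    D^2. The first term has mean 0 and the second has mean at most K C0 / r. This bound passes to
    [P], where r tends to infinity by dominated convergence; the levels are successors so as to be
    positive. *)
Let prior_martingale_le t t' s (phi : (R -> R) -> R) : 0 <= t -> t <= t' -> t' <= T ->
  (forall u, u \in s -> 0 <= u <= t) -> lip_on s phi ->
  \int[P]_w (phi (sval w) * (sval w t' - sval w t)) <= 0.
Proof.
move=> t0 tt' t'T st hphi; have [K [K0 Kb _]] := hphi.
have tT := le_trans tt' t'T.
have sT u : u \in s -> 0 <= u <= T.
  by move=> us; have /andP[-> h]/= := st u us; exact: le_trans h tT.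
have iD := prior_increment_integrable t0 tt' t'T.
have mphi : measurable_fun setT (fun w : Omega T => phi (sval w)).
  apply: (measurable_lip_on (Y := fun u (w : Omega T) => sval w u) hphi).
  by move=> u us; exact: coordinate_measurable (sT u us).
have psi_bd (n : nat) : \int[P]_w (phi (sval w) * clip n.+1%:R (sval w t' - sval w t))
    <= K * C0 / n.+1%:R.
  have n0 : 0 < n.+1%:R :> R by rewrite ltr0n.
  have hl := lip_on_mul hphi (lip_on_increment t t' (ler0n R n.+1)
    (fun x => clip_bounded x (ler0n R n.+1)) (fun x y => clip_lip x y (ler0n R n.+1))).
  apply: (prior_bound BW T0 sl0 _ hl _ PQ).
    move=> u; rewrite mem_cat !inE => /or3P[/sT//|/eqP ->|/eqP ->].
      by rewrite t0.
    by rewrite (le_trans t0).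
  move=> h ah eh.
  pose N u w := step_integral h W u w.
  have [_ i2 b2 mart] := step_integral_increment BW ah t0 tt' t'T.
  have mphiN : past_measurable P0 W t (fun w => phi (fun u => N u w)).
    apply: (@measurable_lip_on _ (g_sigma_algebraType _) R s phi N hphi) => u us.
    have /andP[u0 ut] := st u us.
    have uT : 0 <= u <= T by rewrite u0 (le_trans ut).
    have mNu := past_measurable_mono ut (step_integral_past BW ah uT).
    exact: mNu.
  have mphiW := past_measurableW BW tT mphiN.
  have mDN : measurable_fun setT (fun w => N t' w - N t w).
    by apply: measurable_funB; apply: (step_integral_measurable BW) => //;
          rewrite ?t0 ?(le_trans t0 tt') ?(le_trans tt' t'T).
  have i1 := integrable_sqr mDN i2.
  have Kb' w : `|phi (fun u => N u w)| <= K by exact: Kb.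
  have ip := integrable_mul_bounded mphiW Kb' i1.
  have i3 : L1 P0 (fun w => K / n.+1%:R * (N t' w - N t w) ^+ 2).
    exact: integrable_scale.
  apply: (@le_trans _ _ (\int[P0]_w (phi (fun u => N u w) * (N t' w - N t w) +
      K / n.+1%:R * (N t' w - N t w) ^+ 2))).
    apply: le_Rintegral => //.
    - apply: (integrable_bounded P0 (K := K * n.+1%:R)).
        apply: measurable_funM => //; apply: measurableT_comp => //.
        exact: measurable_clip.
      by move=> w; rewrite normrM ler_pM// clip_bounded.
    - exact: integrable_add.
    - move=> w _; rewrite -lerBlDl -mulrBr.
      rewrite (le_trans (ler_norm _))// normrM -mulrA ler_pM// mulrC.
      exact: clip_error.
  rewrite RintegralD// (mart _ K)// add0r RintegralZl//.
  rewrite [leRHS]mulrAC; apply: ler_wpM2l; first by rewrite divr_ge0.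
  by rewrite (le_trans b2)// ler_wpM2l.
have im (n : nat) : L1 P (fun w => phi (sval w) * clip n.+1%:R (sval w t' - sval w t)).
  apply: (integrable_bounded P (K := K * n.+1%:R)).
    apply: measurable_funM => //; apply: (measurableT_comp (measurable_clip _)).
    exact: integrable_measurable iD.
  by move=> w; rewrite normrM ler_pM// clip_bounded.
have md (n : nat) (w : Omega T) :
    `|phi (sval w) * clip n.+1%:R (sval w t' - sval w t)| <= K * `|sval w t' - sval w t|.
  by rewrite normrM ler_pM// clip_abs.
have me (w : Omega T) : \forall n \near \oo,
    phi (sval w) * clip n.+1%:R (sval w t' - sval w t) =
    phi (sval w) * (sval w t' - sval w t).
  near=> n; congr (_ * _); apply: clip_id.
  rewrite (@le_trans _ _ n%:R)// ?ler_nat//; near: n; exact: nbhs_infty_ger.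
have [_ cv] := dominated_eventually im md (integrable_scale K (integrable_abs iD)) me.
apply/ler_addgt0Pl => e e0; rewrite addr0.
  move/cvgrPdist_le : cv => /(_ (e / 2)).
  rewrite divr_gt0// => /(_ isT) cv.
  have [n [hn1 hn2]] : exists n : nat, `|\int[P]_w (phi (sval w) * (sval w t' - sval w t)) -
      \int[P]_w (phi (sval w) * clip n.+1%:R (sval w t' - sval w t))| <= e / 2 /\
      K * C0 / (e / 2) <= n%:R.
    have : \forall n \near \oo, `|\int[P]_w (phi (sval w) * (sval w t' - sval w t)) -
      \int[P]_w (phi (sval w) * clip n.+1%:R (sval w t' - sval w t))| <= e / 2 /\
      K * C0 / (e / 2) <= n%:R.
      apply: filterS2 cv (nbhs_infty_ger (K * C0 / (e / 2))) => n h1 h2.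
      by split.
    by move=> /filter_ex.
  have := psi_bd n; move: hn1; rewrite ler_distl => /andP[_ h1] h2.
  have h3 : K * C0 / n.+1%:R <= e / 2.
    rewrite ler_pdivrMr ?ltr0n// [leRHS]mulrC -ler_pdivrMr ?divr_gt0//.
    by rewrite (le_trans hn2)// ler_nat.
  apply: (le_trans h1); rewrite [leRHS]splitr lerD2r.
  exact: le_trans h2 h3.
Unshelve. all: by end_near. Qed.

(** The one-sided bound for [phi] and for its opposite. *)
Lemma prior_martingale t t' s (phi : (R -> R) -> R) : 0 <= t -> t <= t' -> t' <= T ->
  (forall u, u \in s -> 0 <= u <= t) -> lip_on s phi ->
  L1 P (fun w => phi (sval w) * (sval w t' - sval w t)) /\
  \int[P]_w (phi (sval w) * (sval w t' - sval w t)) = 0.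
Proof.
move=> t0 tt' t'T st hphi; have [K [K0 Kb Kl]] := hphi.
have tT := le_trans tt' t'T.
have iD := prior_increment_integrable t0 tt' t'T.
have mphi : measurable_fun setT (fun w : Omega T => phi (sval w)).
  apply: (measurable_lip_on (Y := fun u (w : Omega T) => sval w u) hphi).
  move=> u us; apply: coordinate_measurable.
  by have /andP[-> h]/= := st u us; exact: le_trans h tT.
have ip := integrable_mul_bounded mphi (fun w => Kb (sval w)) iD.
split => //; apply/eqP; rewrite eq_le (prior_martingale_le t0 tt' t'T st hphi)/=.
have hN : lip_on s (fun f => - phi f).
  exists K; split => // [f|f g]; first by rewrite normrN.
  by rewrite -opprD normrN.
have := prior_martingale_le t0 tt' t'T st hN.
under eq_Rintegral do rewrite mulNr -mulN1r.
by rewrite RintegralZl// mulN1r oppr_le0.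
Qed.

End prior_martingale.

(** * The martingale property of step integrals of the canonical process *)

Lemma rowvec_norm_le (R : realType) n (v : 'rV[R]_n) (c : R) : 0 <= c ->
  (forall j, `|v 0 j| <= c) -> `|v| <= c.
Proof.
move=> c0 vc; rewrite [leLHS]/Num.norm /= mx_normrE; apply/bigmax_leP.
by split => // -[i j] _ /=; rewrite ord1.
Qed.

Section discrete_martingale.
Context {R : realType} {T : R} (P : probability (Omega T) R).
Local Notation L1 f := (P.-integrable setT (EFin \o f)).
Implicit Types (s : seq R) (phi Psi Xi : (R -> R) -> R).

Definition neg_part (x : R) : R := Num.max (- x) 0.

Lemma neg_part_ge0 x : 0 <= neg_part x.
Proof. by rewrite /neg_part le_max lexx orbT. Qed.

Lemma neg_part_ge x : - x <= neg_part x.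
Proof. by rewrite /neg_part le_max lexx. Qed.

Lemma measurable_neg_part : measurable_fun setT neg_part.
Proof. exact: measurable_maxr. Qed.

Lemma loclip_on_measurable s Psi : (forall u, u \in s -> 0 <= u <= T) ->
  loclip_on s Psi -> measurable_fun setT (fun w : Omega T => Psi (sval w)).
Proof.
move=> sT hPsi.
apply: (measurable_loclip_on (Y := fun u (w : Omega T) => sval w u) hPsi).
by move=> u us; exact: coordinate_measurable (sT u us).
Qed.

Hypothesis mart : forall t t' s phi, 0 <= t -> t <= t' -> t' <= T ->
  (forall u, u \in s -> 0 <= u <= t) -> lip_on s phi ->
  L1 (fun w => phi (sval w) * (sval w t' - sval w t)) /\
  \int[P]_w (phi (sval w) * (sval w t' - sval w t)) = 0.

Section one_step.
Variables (t t' : R) (s : seq R) (Psi Xi : (R -> R) -> R).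
Hypotheses (t0 : 0 <= t) (tt' : t <= t') (t'T : t' <= T).
Hypothesis st : forall u, u \in s -> 0 <= u <= t.
Hypotheses (hPsi : loclip_on s Psi) (hXi : loclip_on s Xi).

Let X (w : Omega T) := Psi (sval w).
Let X' (w : Omega T) := Psi (sval w) + Xi (sval w) * (sval w t' - sval w t).

Let sT u : u \in s -> 0 <= u <= T.
Proof. by move=> us; have /andP[-> h]/= := st us; rewrite (le_trans h)// (le_trans tt'). Qed.

Let mX : measurable_fun setT X. Proof. exact: loclip_on_measurable sT hPsi. Qed.

Let mX' : measurable_fun setT X'.
Proof.
apply: measurable_funD => //; apply: measurable_funM.
  exact: loclip_on_measurable sT hXi.
by apply: measurable_funB; apply: coordinate_measurable;
  rewrite ?t0 ?(le_trans t0 tt') ?(le_trans tt' t'T).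
Qed.

(** [X] and [X'] need not be integrable. A weight that is cut off in the past values makes its
    product with [Xi] bounded and Lipschitz, so that [mart] applies and the weighted means agree. *)
Let truncated g (n : nat) : loclip_on s g ->
  let V (w : Omega T) := cutoff s n%:R (sval w) * g (sval w) in
  [/\ L1 (fun w => V w * X w), L1 (fun w => V w * X' w) &
      \int[P]_w (V w * X' w) = \int[P]_w (V w * X w)].
Proof.
move=> hg V.
have h1 := cutoff_lip_on n%:R (loclip_on_mul hg hPsi).
have h2 := cutoff_lip_on n%:R (loclip_on_mul hg hXi).
have [i2 e2] := mart t0 tt' t'T st h2.
have i1 : L1 (fun w => V w * X w).
  have -> : (fun w => V w * X w) =
      fun w : Omega T => cutoff s n%:R (sval w) * (g (sval w) * Psi (sval w)).
    by apply/funext => w; rewrite /V mulrA.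
  have [K [_ Kb _]] := h1.
  apply: (integrable_bounded P (K := K)); last by move=> w; exact: Kb.
  exact: loclip_on_measurable sT (lip_on_loclip h1).
have E w : V w * X' w = V w * X w +
    cutoff s n%:R (sval w) * (g (sval w) * Xi (sval w)) * (sval w t' - sval w t).
  by rewrite /V /X /X'; ring.
split => //.
  under [Y in EFin \o Y]eq_fun do rewrite E.
  exact: integrable_add.
under eq_Rintegral do rewrite E.
by rewrite RintegralD// e2 addr0.
Qed.

(* The weights V n are 1 eventually where X < 0 and vanish where X >= 0. *)
Lemma neg_part_step : L1 (neg_part \o X') -> L1 (neg_part \o X).
Proof.
move=> iX'.
(* A Lipschitz substitute for the indicator of negative values; its constant [n] may grow, since
   each [n] is used separately. *)
pose g (n : nat) := (fun x : R => Num.min 1 (n%:R * neg_part x)) \o Psi.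
have hg n : loclip_on s (g n).
  apply: (loclip_on_comp (M := n%:R)) => // x y.
  have n0 : 0 <= n%:R :> R by exact: ler0n.
  apply: (@le_trans _ _ `|n%:R * neg_part x - n%:R * neg_part y|).
    rewrite !ler_norml.
    set a := n%:R * neg_part x; set b := n%:R * neg_part y.
    have := ler_norm (a - b); have := ler_norm (b - a); rewrite (distrC b a).
    set d := `|a - b| => h1 h2; have d0 : 0 <= d by exact: normr_ge0.
    by case: (leP 1 a) => c1; case: (leP 1 b) => c2; apply/andP; split; lra.
  rewrite -mulrBr normrM ger0_norm// ler_wpM2l// /neg_part.
  have := ler_norm (x - y); have := ler_norm (y - x); rewrite (distrC y x).
  set d := `|x - y| => h1 h2; have d0 : 0 <= d by exact: normr_ge0.
  rewrite ler_norml.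
  by case: (leP (- x) 0) => c1; case: (leP (- y) 0) => c2; apply/andP; split; lra.
pose V n (w : Omega T) := cutoff s n%:R (sval w) * g n (sval w).
have g0 n (w : Omega T) : 0 <= g n (sval w).
  by rewrite /g/= le_min ler01 mulr_ge0 ?neg_part_ge0.
have g1 n (w : Omega T) : g n (sval w) <= 1 by rewrite /g/= ge_min lexx.
have V0 n w : 0 <= V n w by rewrite mulr_ge0// cutoff_ge0.
have V1 n w : V n w <= 1 by rewrite mulr_ile1 ?cutoff_ge0 ?cutoff_le1.
have VX n w : V n w * neg_part (X w) = - (V n w * X w).
  have [X0|X0] := leP 0 (X w).
    have e : neg_part (X w) = 0 by rewrite /neg_part max_r// oppr_le0.
    by rewrite /V /g/= -/(X w) e !mulr0 min_r ?ler01// mulr0 mul0r oppr0.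
  by rewrite /neg_part max_l ?mulrN// oppr_ge0 ltW.
have iV n : L1 (fun w => V n w * neg_part (X w)).
  under [Y in EFin \o Y]eq_fun do rewrite VX -mulN1r.
  by apply: integrable_scale; have [] := truncated n (hg n).
(* The left side is the mean of - V X, hence that of - V X', and - V X' is at most the negative part
   of X' because V lies between 0 and 1. *)
have bV n : \int[P]_w (V n w * neg_part (X w)) <= \int[P]_w neg_part (X' w).
  have [i1 i2 e] := truncated n (hg n).
  under eq_Rintegral do rewrite VX -mulN1r.
  rewrite RintegralZl// -e -RintegralZl//.
  apply: le_Rintegral => //; first exact: integrable_scale.
  move=> w _; rewrite mulN1r -mulrN.
  have := neg_part_ge (X' w); have := neg_part_ge0 (X' w).
  by have := V0 n w; have := V1 n w; rewrite /V; nra.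
have V_ev w : \forall n \near \oo, V n w * neg_part (X w) = neg_part (X w).
  have [X0|X0] := leP 0 (X w).
    have -> : neg_part (X w) = 0 by rewrite /neg_part max_r// oppr_le0.
    by near=> n; rewrite mulr0.
  have p0 : 0 < neg_part (X w).
    by rewrite (lt_le_trans _ (neg_part_ge _))// oppr_gt0.
  apply: filterS2 (cutoff_eventually s (sval w)) (nbhs_infty_ger (neg_part (X w))^-1).
  move=> n c1 hn; rewrite /V c1 mul1r /g/= min_l ?mul1r//.
  by rewrite -/(X w) -ler_pdivrMr// div1r.
have VN n w : 0 <= V n w * neg_part (X w) by rewrite mulr_ge0 ?neg_part_ge0.
by have [] := fatou_bound iV VN V_ev bV.
Unshelve. all: by end_near. Qed.

(** As |x| = x + 2 x^-, the mean of V |X'| is at most that of V X' + 2 X'^-, where V X' may be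
    exchanged for V X. This is bounded uniformly in the cutoff, so Fatou's lemma makes X'
    integrable; dominated convergence then removes the cutoff from the equality of means. *)
Lemma martingale_step : L1 (neg_part \o X') -> L1 X ->
  L1 X' /\ \int[P]_w X' w = \int[P]_w X w.
Proof.
move=> iN iX.
pose V (n : nat) (w : Omega T) := cutoff s n%:R (sval w).
have V0 n w : 0 <= V n w by exact: cutoff_ge0.
have V1 n w : V n w <= 1 by exact: cutoff_le1.
have tr n : [/\ L1 (fun w => V n w * X w), L1 (fun w => V n w * X' w) &
      \int[P]_w (V n w * X' w) = \int[P]_w (V n w * X w)].
  rewrite (_ : V n = fun w => cutoff s n%:R (sval w) * 1).
    exact: (truncated n (loclip_on_cst s 1)).
  by apply/funext => w; rewrite mulr1.
have mV n : measurable_fun setT (V n).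
  exact: loclip_on_measurable sT (loclip_cutoff s n%:R).
have V_ev w : \forall n \near \oo, V n w = 1 by exact: cutoff_eventually.
have bVX n w : `|V n w * X w| <= `|X w|.
  by rewrite normrM ger0_norm// ler_piMl.
have bVX' n w : `|V n w * X' w| <= `|X' w|.
  by rewrite normrM ger0_norm// ler_piMl.
have iV n : L1 (fun w => V n w * `|X' w|).
  have [_ i2 _] := tr n.
  have -> : (fun w => V n w * `|X' w|) = fun w => `|V n w * X' w|.
    by apply/funext => w; rewrite normrM (ger0_norm (V0 _ _)).
  exact: integrable_abs.
have iB : L1 (fun w => `|X w| + 2 * neg_part (X' w)).
  by apply: integrable_add; [exact: integrable_abs|exact: integrable_scale].
have bV n : \int[P]_w (V n w * `|X' w|) <= \int[P]_w (`|X w| + 2 * neg_part (X' w)).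
  have [i1 i2 e] := tr n.
  have iN2 : L1 (fun w => 2 * neg_part (X' w)) by exact: integrable_scale.
  apply: (@le_trans _ _ (\int[P]_w (V n w * X' w + 2 * neg_part (X' w)))).
    apply: le_Rintegral => //; first exact: integrable_add.
    move=> w _; have := V0 n w; have := V1 n w.
    have := neg_part_ge (X' w); have := neg_part_ge0 (X' w).
    by have [x0|x0] := leP 0 (X' w); [rewrite ger0_norm//|rewrite ltr0_norm//]; nra.
  rewrite RintegralD// e [leRHS]RintegralD//; last exact: integrable_abs.
  rewrite lerD2r; apply: le_Rintegral => //; first exact: integrable_abs.
  by move=> w _; rewrite (le_trans (ler_norm _)).
have VE (f : Omega T -> R) w : \forall n \near \oo, V n w * f w = f w.
  by apply: filterS (V_ev w) => n ->; rewrite mul1r.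
have [iaX' _] := fatou_bound iV (fun n w => mulr_ge0 (V0 n w) (normr_ge0 (X' w)))
  (VE (fun w => `|X' w|)) bV.
have iX' : L1 X' by exact: (integrable_le mX' iaX').
split => //.
have [_ c1] := dominated_eventually (fun n => let: And3 i _ _ := tr n in i) bVX
  (integrable_abs iX) (VE X).
have [_ c2] := dominated_eventually (fun n => let: And3 _ i _ := tr n in i) bVX'
  (integrable_abs iX') (VE X').
have E : (fun n => \int[P]_w (V n w * X' w)) = fun n => \int[P]_w (V n w * X w).
  by apply/funext => n; have [_ _ ->] := tr n.
rewrite E in c2.
by rewrite -(cvg_lim (@Rhausdorff R) c2) (cvg_lim (@Rhausdorff R) c1).
Qed.

End one_step.

(** The norm of the vector of sampled values is at most [size_on], so on a ball of radius r the
    polynomial factor in the Lipschitz bound is at most a constant. *)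
Lemma Lip_loclip t (X : Omega T -> R) : Lip t X ->
  exists s Psi, [/\ forall u, u \in s -> 0 <= u <= t, loclip_on s Psi &
                    forall w, X w = Psi (sval w)].
Proof.
move=> [n [u [phi [ut [K [k hK]] ->]]]].
exists [seq u i | i <- enum 'I_n.+1], (fun f => phi (\row_i f (u i))); split => //.
  by move=> v /mapP[i _ ->]; have := ut i; rewrite in_itv.
set s := [seq u i | i <- enum 'I_n.+1].
have us i : u i \in s by apply: map_f; rewrite mem_enum.
have row_le f g : `|(\row_i f (u i) : 'rV[R]_n.+1) - \row_i g (u i)| <= dist_on s f g.
  apply: rowvec_norm_le => [|j]; first exact: dist_on_ge0.
  rewrite !mxE; exact: dist_on_mem.
have row_size f : `|(\row_i f (u i) : 'rV[R]_n.+1)| <= size_on s f.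
  apply: rowvec_norm_le => [|j]; first exact: size_on_ge0.
  rewrite !mxE; exact: size_on_mem.
move=> r.
pose L := `|K| * (1 + `|r| ^+ k + `|r| ^+ k).
have L0 : 0 <= L by rewrite mulr_ge0// !addr_ge0// exprn_ge0.
have lip f g : size_on s f <= r -> size_on s g <= r ->
    `|phi (\row_i f (u i)) - phi (\row_i g (u i))| <= L * dist_on s f g.
  move=> fr gr; apply: (le_trans (hK _ _)).
  apply: (@le_trans _ _ (L * `|(\row_i f (u i) : 'rV[R]_n.+1) - \row_i g (u i)|)); last first.
    exact: ler_wpM2l.
  apply: ler_wpM2r => //.
  have rn f' : size_on s f' <= r -> `|(\row_i f' (u i) : 'rV[R]_n.+1)| ^+ k <= `|r| ^+ k.
    move=> h; rewrite lerXn2r ?nnegrE// (le_trans (row_size _))// (le_trans h)//.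
    exact: ler_norm.
  apply: (@le_trans _ _ (`|K| * (1 + `|(\row_i f (u i) : 'rV[R]_n.+1)| ^+ k +
      `|(\row_i g (u i) : 'rV[R]_n.+1)| ^+ k))).
    by apply: ler_wpM2r; [rewrite !addr_ge0// exprn_ge0|exact: ler_norm].
  by apply: ler_wpM2l => //; rewrite lerD ?lerD2l ?rn.
(* Comparison with the zero path turns the Lipschitz bound on the ball into a bound on the
   values. *)
pose z : R -> R := fun=> 0.
exists (L + L * `|r| + `|phi (\row_i z (u i))|); split.
  by rewrite !addr_ge0// mulr_ge0.
move=> f g fr gr; split.
  have r0 : 0 <= r by exact: le_trans (size_on_ge0 s f) fr.
  have zr : size_on s z <= r.
    by rewrite /size_on big1// => v _; rewrite normr0.
  have dz : dist_on s f z <= `|r|.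
    rewrite /dist_on (eq_bigr (fun v => `|f v|)); last by move=> v _; rewrite subr0.
    by rewrite (le_trans fr)// ler_norm.
  have := lip f z fr zr => h.
  rewrite -(subrK (phi (\row_i z (u i))) (phi (\row_i f (u i)))).
  rewrite (le_trans (ler_normD _ _))// lerD2r (le_trans h)//.
  by rewrite -[leLHS]add0r lerD// ler_wpM2l.
rewrite (le_trans (lip f g fr gr))// ler_wpM2r ?dist_on_ge0//.
by rewrite -addrA lerDl addr_ge0// mulr_ge0.
Qed.

(** Integrability of the negative part is given at the last node and descends to earlier ones by
    [neg_part_step]; integrability and mean 0 then climb back from the first node by
    [martingale_step]. A single induction does both, since the claim at each node is an
    implication. *)
Lemma Lip_step_martingale (h : step T) : Lip_step h ->
  let X w := step_integral h B T w in
  L1 (neg_part \o X) -> L1 X /\ \int[P]_w X w = 0.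
Proof.
move=> [ph lh] X.
pose N := step_size h.
pose Y k (w : Omega T) := \sum_(j < k) step_coef h j w *
  (sval w (step_node h j.+1) - sval w (step_node h j)).
have XE : X = Y N.
  apply/funext => w; rewrite /X /step_integral /B; apply: eq_bigr => j _.
  have /andP[_ h1] := partition_itv ph (ltnW (ltn_ord j)).
  have /andP[_ h2] := partition_itv ph (ltn_ord j).
  by rewrite !min_l.
have key k : (k <= N)%N -> exists s Psi,
    [/\ forall u, u \in s -> 0 <= u <= step_node h k, loclip_on s Psi,
        forall w, Y k w = Psi (sval w) &
        L1 (neg_part \o Y k) -> L1 (Y k) /\ \int[P]_w Y k w = 0].
  elim: k => [|k IH] kN.
    exists [::], (fun=> 0); split => //; first exact: loclip_on_cst.
      by move=> w; rewrite /Y big_ord0.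
    move=> _; under [Z in EFin \o Z]eq_fun do rewrite /Y big_ord0.
    under eq_Rintegral do rewrite /Y big_ord0.
    by rewrite Rintegral_const; split => //; exact: integrable_cst.
  have [s [Psi [st hPsi YE mY]]] := IH (ltnW kN).
  have [s' [Xi [st' hXi XiE]]] := Lip_loclip (lh k kN).
  have /andP[k0 _] := partition_itv ph (ltnW kN).
  have /andP[_ kT] := partition_itv ph kN.
  have kk : step_node h k <= step_node h k.+1.
    by apply: (partition_le ph); rewrite leqnSn.
  have sst u : u \in s ++ s' -> 0 <= u <= step_node h k.
    by rewrite mem_cat => /orP[/st|/st'].
  have YSE w : Y k.+1 w = Psi (sval w) +
      Xi (sval w) * (sval w (step_node h k.+1) - sval w (step_node h k)).
    by rewrite /Y big_ord_recr/= -YE -XiE.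
  have YkE : Y k = fun w => Psi (sval w) by apply/funext.
  have YkSE : Y k.+1 = fun w => Psi (sval w) +
      Xi (sval w) * (sval w (step_node h k.+1) - sval w (step_node h k)).
    by apply/funext.
  have hP' := loclip_on_catl s' hPsi.
  have hX' := loclip_on_catr s hXi.
  pose s2 := [:: step_node h k; step_node h k.+1].
  exists ((s ++ s') ++ s2), (fun f => Psi f +
    Xi f * (f (step_node h k.+1) - f (step_node h k))); split => //.
  - move=> u; rewrite mem_cat !inE => /or3P[/sst/andP[-> h1]/=|/eqP ->|/eqP ->].
    + exact: le_trans h1 kk.
    + by rewrite k0.
    + by rewrite lexx (le_trans k0 kk).
  - apply: loclip_on_add; first exact: loclip_on_catl.
    apply: loclip_on_mul; first exact: loclip_on_catl.
    have -> : (fun f : R -> R => f (step_node h k.+1) - f (step_node h k)) =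
      (fun f => f (step_node h k.+1) + (-1) * f (step_node h k)).
      by apply/funext => f; rewrite mulN1r.
    apply: loclip_on_add.
      by apply: loclip_on_eval; rewrite mem_cat !inE eqxx !orbT.
    apply: loclip_on_mul; first exact: loclip_on_cst.
    by apply: loclip_on_eval; rewrite mem_cat !inE eqxx !orbT.
  - rewrite YkSE => iN.
    have iNk := neg_part_step k0 kk kT sst hP' hX' iN.
    rewrite YkE in mY; have [iY EY] := mY iNk.
    by rewrite -[in X in _ /\ X]EY; exact: (martingale_step k0 kk kT sst hP' hX' iN iY).
have [s [Psi [_ _ _ hN]]] := key N (leqnn N).
by rewrite XE.
Qed.

End discrete_martingale.

(** * The market *)

Section market_lemmas.
Context {R : realType} {T : R}.

(** The product of [gamma] and exp (- r x) has zero derivative on ]0, T[ and value 1 at 0, so by the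
    mean value theorem it is 1 at [T]. *)
Lemma bond_gt0 (r : R) (gamma : R -> R) : 0 < T -> is_bond (T := T) r gamma ->
  0 < gamma T.
Proof.
move=> T0 [g0 cg dg].
pose e (x : R) : R := expR (- r * x).
have de (x : R) : is_derive x 1 e (- r * e x).
  have h1 : is_derive x 1 (fun y : R => - r * y) (- r).
    have := @is_deriveZ R R _ id (- r) x 1 1 _.
    by rewrite /= => h; apply: is_derive_eq (h _) _; rewrite /GRing.scale/= mulr1.
  have := @is_derive1_comp R expR (fun y => - r * y) x _ _ (is_derive_expR _) h1.
  by move=> h; apply: is_derive_eq h _; rewrite mulrC.
pose f (x : R) := gamma x * e x.
have df x : x \in `]0, T[ -> is_derive x 1 f (0 : R).
  move=> xT; have h := @is_deriveM R R gamma e x 1 _ _ (dg x xT) (de x).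
  by apply: is_derive_eq h _; rewrite /GRing.scale/=; ring.
have ce : continuous e.
  move=> x; apply: differentiable_continuous; apply/derivable1_diffP.
  by have [] := de x.
have cf : {within `[0, T], continuous f}.
  by move=> x; apply: cvgM; [exact: cg|exact: continuous_subspaceT].
have [c _] := MVT T0 df cf.
rewrite mul0r /f g0 /e mulr0 expR0 mulr1 => /eqP; rewrite subr_eq0 => /eqP h.
by rewrite -(pmulr_lgt0 (gamma T) (expR_gt0 (- r * T))) h.
Qed.

(** Every Stieltjes sum vanishes, so it suffices to exhibit, for each tolerance, one partition that
    is fine enough; a uniform one serves. *)
Lemma stieltjes_zero (f c : R -> R) (J : R) : 0 < T ->
  (forall t, t \in `[0, T] -> c t = 0) -> is_stieltjes f c T J -> J = 0.
Proof.
move=> T0 c0 hJ; apply/eqP; rewrite -normr_le0; apply/ler_addgt0Pl => e e0.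
rewrite addr0; have [d d0 hd] := hJ e e0.
pose n := (Num.bound (T / d)).+1.
have n0 : 0 < n%:R :> R by rewrite ltr0n.
have hn : T / d < n%:R.
  apply: (lt_trans (archi_boundP _)); last by rewrite ltr_nat.
  by rewrite divr_ge0// ltW.
pose u (j : nat) : R := T * j%:R / n%:R.
have uS j : u j.+1 - u j = T / n%:R by rewrite /u -natr1; field; rewrite gt_eqF.
have pu : Defs.partition 0 T n u.
  split; first by rewrite /u mulr0 mul0r.
    by rewrite /u mulfK// gt_eqF.
  by move=> j _; rewrite -subr_gt0 uS divr_gt0.
have := hd n u u pu.
rewrite big1 ?sub0r ?normrN; last first.
  move=> j _; rewrite !c0 ?subrr ?mulr0// in_itv/=.
    exact: (partition_itv pu (ltnW (ltn_ord j))).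
  exact: (partition_itv pu (ltn_ord j)).
move=> h; apply/ltW/h => j jn; split.
  by rewrite uS ltr_pdivrMr// mulrC -ltr_pdivrMr.
by rewrite lexx/= -subr_ge0 uS divr_ge0// ltW.
Qed.

(** The supremum over all priors dominates the L1-norm under each of them. *)
Lemma LG_norm1_cvg (Q : set (probability (Omega T) R)) (P : probability (Omega T) R)
    (f_ : nat -> Omega T -> R) :
  Q P -> LG_norm Q 1 (f_ n) @[n --> \oo] --> 0%E ->
  forall e : R, 0 < e ->
    \forall n \near \oo, (\int[P]_w (`|f_ n w|)%:E <= e%:E)%E.
Proof.
move=> QP cf e e0; apply: filterS (cvg0_le cf e0) => n.
(* Removing the exponent 1 requires a nonnegative supremum, of which [P] is the witness. *)
apply: le_trans; rewrite /LG_norm invr1 poweRe1; last first.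
  apply: (@le_trans _ _ (\int[P]_w (`|f_ n w| `^ 1)%:E)%E).
    by apply: integral_ge0 => w _; rewrite lee_fin powR_ge0.
  by apply: ereal_sup_ubound; exists P.
rewrite /E_G; apply: ereal_sup_ubound; exists P => //.
by apply: eq_integral => w _; rewrite powRr1.
Qed.

End market_lemmas.

(** * Nonnegative G-integrals *)

Section G_integral.
Context {R : realType} {T : R} (P0 : probability (Omega T) R).
Variables (W : R -> Omega T -> R) (sl su : R).
Hypotheses (BW : brownian_motion P0 W) (T0 : 0 < T) (sl0 : 0 < sl).
Let Q := priors P0 W sl su.

Lemma Lip_measurable t (X : Omega T -> R) : t <= T -> Lip t X -> measurable_fun setT X.
Proof.
move=> tT /Lip_loclip[s [Psi [st hPsi XE]]].
have -> : X = fun w => Psi (sval w) by apply/funext.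
apply: loclip_on_measurable hPsi => u us.
by have /andP[-> h]/= := st u us; exact: le_trans h tT.
Qed.

(* A nonnegative G-integral bounds from below, up to an L1-error, the step
   integrals approximating it, so these are genuine martingales. *)
Lemma ge0_G_integral_eq0 (eta : R -> Omega T -> R) (I : Omega T -> R)
    (P : probability (Omega T) R) : Q P -> is_G_integral Q 1 eta T I ->
  {ae P, forall w, 0 <= I w} -> {ae P, forall w, I w = 0}.
Proof.
move=> QP [_ mI [h [hL _] cI]] I0.
pose X n w := step_integral (h n) B T w.
have Tle : 0 <= T <= T by rewrite lexx ltW.
have mX n : measurable_fun setT (X n).
  have [ph lh] := hL n.
  apply: measurable_sum => j.
  have /andP[h1 h2] := partition_itv ph (ltnW (ltn_ord j)).
  have /andP[h3 h4] := partition_itv ph (ltn_ord j).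
  apply: measurable_funM; first exact: (Lip_measurable h2 (lh j (ltn_ord j))).
  by rewrite !min_l//; apply: measurable_funB; apply: coordinate_measurable;
    apply/andP.
have mart := prior_martingale BW T0 sl0 QP.
(* [I] is nonnegative only almost surely. With the version [J], nonnegative everywhere, the negative
   part of [X n] is at most |J - X n| at every point. *)
pose J w := Num.max (I w) 0.
have J0 w : 0 <= J w by rewrite le_max lexx orbT.
have mJ : measurable_fun setT J by exact: measurable_maxr.
have JI : {ae P, forall w, J w = I w}.
  by apply: filterS I0 => w Iw; rewrite /J max_l.
(* Once [X n] is known to have mean 0, the mean of [J] is that of J - X n, which is at most the
   L1-error. *)
have intJ e : 0 < e -> (\int[P]_w `|(J w)%:E| <= e%:E)%E.
  move=> e0; have [n hn] := filter_ex (LG_norm1_cvg QP cI e0).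
  have mD : measurable_fun setT (fun w => J w - X n w) by exact: measurable_funB.
  have hD : (\int[P]_w (`|J w - X n w|)%:E <= e%:E)%E.
    rewrite (@ge0_ae_eq_integral _ _ _ P setT _ (fun w => (`|I w - X n w|)%:E))//.
    - by apply/measurable_EFinP; exact: measurableT_comp.
    - apply/measurable_EFinP; apply: measurableT_comp => //.
      exact: measurable_funB.
    - by apply: filterS JI => w -> _.
  have [iaD bD] := ge0_integrable_le (measurableT_comp (@normr_measurable R setT) mD)
    (fun w => normr_ge0 _) hD.
  have iD : P.-integrable setT (EFin \o (fun w => J w - X n w)).
    exact: (integrable_le mD iaD).
  have iN : P.-integrable setT (EFin \o (@neg_part R \o X n)).
    apply: (integrable_le _ iaD).
      by apply: measurableT_comp => //; exact: measurable_neg_part.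
    move=> w /=; rewrite (ger0_norm (neg_part_ge0 _)) /neg_part ge_max normr_ge0 andbT.
    by rewrite (le_trans _ (ler_norm _))// lerDr.
  have [iX EX] := Lip_step_martingale mart (hL n) iN.
  have iJ : P.-integrable setT (EFin \o J).
    have -> : J = fun w => (J w - X n w) + X n w by apply/funext => w; rewrite subrK.
    exact: integrable_add.
  under eq_integral do rewrite /= ger0_norm//.
  rewrite (Rintegral_EFin iJ) lee_fin.
  have -> : \int[P]_w J w = \int[P]_w ((J w - X n w) + X n w).
    by apply: eq_Rintegral => w _; rewrite subrK.
  rewrite RintegralD// EX addr0 (le_trans _ bD)//.
  by apply: le_Rintegral => // w _; exact: ler_norm.
have J_int0 : (\int[P]_w `|(EFin \o J) w| = 0)%E.
  apply/eqP; rewrite eq_le integral_ge0// andbT.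
  by apply/lee_addgt0Pr => e e0; rewrite add0e intJ.
have mJE : measurable_fun setT (EFin \o J) by exact/measurable_EFinP.
have := (ae_eq_integral_abs P measurableT mJE).1 J_int0.
by apply: filterS2 JI => w JwI /(_ Logic.I)[Jw0]; rewrite -JwI.
Qed.

End G_integral.

Theorem lemma3p3 (R : realType) (T sl su r x0 : R)
  (P0 : probability (Omega T) R) (W : R -> Omega T -> R)
  (gamma : R -> R) (S : R -> Omega T -> R) :
  0 < T -> 0 < sl -> sl < su -> 0 <= r -> 0 < x0 ->
  brownian_motion P0 W ->
  let F := filtration P0 W in
  let Q := priors P0 W sl su in
  is_bond (T := T) r gamma -> is_stock Q r x0 S ->
  ~ exists (y : R) (pi C X : R -> Omega T -> R),
      [/\ y <= 0,
          admissible F Q gamma y pi C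
            /\ qs Q [set w | forall t : R, t \in `[0, T] -> C t w = 0],
          is_wealth_process Q gamma y pi C X,
          qs Q [set w | 0 <= X T w] &
          exists2 P, Q P & (0 < P [set w | (0 < X T w)%R])%E].
Proof.
move=> T0 sl0 _ _ _ BW F Q hbond _ [y [pi [C [X [y0 [_ C0] [wX _] X0 [P QP PX]]]]]].
have TT : T \in `[0, T] by rewrite in_itv/= lexx ltW.
have gT := bond_gt0 T0 hbond.
have [mX [I hI eqX]] := wX T TT.
have qs_ae (A : set (Omega T)) : qs Q A -> {ae P, forall w, A w}.
  by move=> [N [mN N0 AN]]; exists N; split => //; exact: N0.
(* Outside a null set the consumption path is identically 0, so any Stieltjes value [J] in the
   wealth equation is 0. *)
have XI : {ae P, forall w, (gamma T)^-1 * X T w = y + I w}.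
  apply: filterS2 (qs_ae _ eqX) (qs_ae _ C0) => w [J hJ ->] Cw.
  by rewrite (stieltjes_zero T0 Cw hJ) subr0.
have I0 : {ae P, forall w, 0 <= I w}.
  apply: filterS2 XI (qs_ae _ X0) => w e Xw.
  have : 0 <= (gamma T)^-1 * X T w by rewrite mulr_ge0// invr_ge0 ltW.
  by rewrite e; lra.
have Ieq := ge0_G_integral_eq0 BW T0 sl0 QP hI I0.
have Xle : {ae P, forall w, ~ (0 < X T w)}.
  apply: filterS2 XI Ieq => w e Iw0 Xw.
  have : 0 < (gamma T)^-1 * X T w by rewrite mulr_gt0// invr_gt0.
  by rewrite e Iw0 addr0; lra.
have mpos : measurable [set w | 0 < X T w].
  rewrite (_ : [set w | 0 < X T w] = setT `&` X T @^-1` `]0, +oo[%classic).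
    by apply: mX => //; exact: measurable_itv.
  by apply/seteqP; split => w /=; rewrite in_itv/= andbT; [move=> ?; split|case].
have : P.-negligible [set w | 0 < X T w].
  by apply: negligibleS Xle => w /= Xw; exact.
by move=> /(measure_negligible mpos) P0'; rewrite P0' ltxx in PX.
Qed.
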